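(* Let $1 < p < \infty$ and let $\Omega \subset \mathbb{R}^n$ be a bounded convex domain. For $x \in \Omega$ let $\delta(x) = \min_{\xi \in \partial\Omega} |x - \xi|$. Then $$\int_{\Omega} \left|\frac{\zeta(x)}{\delta(x)}\right|^{p} dx \leq \left(\frac{p}{p-1}\right)^{p} \int_{\Omega} |\nabla \zeta(x)|^{p}\, dx$$ holds for all $\zeta \in C^{\infty}_{0}(\Omega)$.
   Context: A domain is a nonempty connected open subset of $\mathbb{R}^n$, $n \geq 1$. $C^\infty_0(\Omega)$ denotes the real-valued smooth functions with compact support in $\Omega$. $|\cdot|$ is the Euclidean norm and $dx$ is Lebesgue measure. *)

(* Defs.v *)
From HB Require Import structures.
From mathcomp Require Import all_boot all_order all_algebra.
From mathcomp Require Import all_classical all_reals all_analysis.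
From mathcomp Require Import measurable_realfun.
Set Implicit Arguments.
Unset Strict Implicit.
Unset Printing Implicit Defensive.
Import Order.TTheory GRing.Theory Num.Theory.
Import numFieldNormedType.Exports.
Local Open Scope classical_set_scope.
Local Open Scope ring_scope.

Definition measure_rV_display : measure_display -> measure_display.
Proof. exact. Qed.

(* The product sigma-algebra, generated by the coordinate maps. Over the
   reals it is the Borel sigma-algebra (open_measurable_rV below). *)
Section measurable_rV.
Context {d} {T : measurableType d}.
Variable n : nat.

Let coors : 'I_n -> 'rV[T]_n -> T := fun i x => x ord0 i.

Let rV_set0 : g_sigma_preimage coors set0.
Proof. exact: sigma_algebra0. Qed.

Let rV_setC A : g_sigma_preimage coors A -> g_sigma_preimage coors (~` A).
Proof. exact: sigma_algebraC. Qed.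

Let rV_bigcup (F : _^nat) : (forall i, g_sigma_preimage coors (F i)) ->
  g_sigma_preimage coors (\bigcup_i (F i)).
Proof. exact: sigma_algebra_bigcup. Qed.

HB.instance Definition _ := @isMeasurable.Build (measure_rV_display d)
  'rV[T]_n (g_sigma_preimage coors) rV_set0 rV_setC rV_bigcup.
End measurable_rV.

Lemma measurable_coord d (T : measurableType d) n (i : 'I_n) :
  measurable_fun [set: 'rV[T]_n] (fun v : 'rV[T]_n => v ord0 i).
Proof.
move=> _ Y mY; rewrite setTI; apply: sub_sigma_algebra => /=.
rewrite -bigcup_seq/=; exists i => /=; first by rewrite mem_index_enum.
by exists Y => //; rewrite setTI.
Qed.

Lemma measurable_fun_coordP d1 d2 (T1 : measurableType d1)
    (T2 : measurableType d2) n (f : T1 -> 'rV[T2]_n) :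
  measurable_fun [set: T1] f <->
  forall i, measurable_fun [set: T1] (fun x => f x ord0 i).
Proof.
split=> [mf i|mf].
  exact: (measurableT_comp (@measurable_coord _ _ n i)).
have : g_sigma_preimage (fun i => (fun v : 'rV[T2]_n => v ord0 i) \o f)
    `<=` measurable.
  apply: smallest_sub; first exact: sigma_algebra_measurable.
  rewrite -bigcup_seq; apply: bigcup_sub => i _ A [B mB <-]; exact: mf.
by rewrite g_sigma_preimage_comp => prefS _ A mA; apply: prefS; exists A.
Qed.

Section lebesgue_rV.
Context {R : realType}.

Definition cons_rV n (z : measurableTypeR R * 'rV[R]_n) : 'rV[R]_n.+1 :=
  \row_i oapp (z.2 ord0) z.1 (unlift ord0 i).

Lemma cons_rV0 n (z : measurableTypeR R * 'rV[R]_n) : cons_rV z ord0 ord0 = z.1.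
Proof. by rewrite mxE unlift_none. Qed.

Lemma cons_rVS n (z : measurableTypeR R * 'rV[R]_n) j :
  cons_rV z ord0 (lift ord0 j) = z.2 ord0 j.
Proof. by rewrite mxE liftK. Qed.

Lemma measurable_cons_rV n : measurable_fun [set: _] (@cons_rV n).
Proof.
apply/measurable_fun_coordP => i; case: (unliftP ord0 i) => [j|] ->.
  rewrite (_ : (fun _ => _) = (fun v : 'rV[R]_n => v ord0 j) \o snd).
    exact: measurableT_comp (@measurable_coord _ _ n j) measurable_snd.
  by apply/funext => z; rewrite cons_rVS.
rewrite (_ : (fun _ => _) = fst); first exact: measurable_fst.
by apply/funext => z; rewrite cons_rV0.
Qed.

Section lebesgue_rVS.
Local Open Scope ereal_scope.
Variables (n : nat) (mu : {sigma_finite_measure set 'rV[R]_n -> \bar R}).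

Definition lebesgue_rVS : set 'rV[R]_n.+1 -> \bar R :=
  pushforward (@lebesgue_measure R \x mu) (@cons_rV n).

HB.instance Definition _ := isMeasurableFun.Build _ _ _ _ (@cons_rV n)
  (@measurable_cons_rV n).

Let lebesgue_rVS0 : lebesgue_rVS set0 = 0.
Proof. exact: measure0. Qed.

Let lebesgue_rVS_ge0 A : 0 <= lebesgue_rVS A.
Proof. exact: measure_ge0. Qed.

Let lebesgue_rVS_sigma_additive : semi_sigma_additive lebesgue_rVS.
Proof. exact: measure_semi_sigma_additive. Qed.

HB.instance Definition _ := isMeasure.Build _ _ _ lebesgue_rVS
  lebesgue_rVS0 lebesgue_rVS_ge0 lebesgue_rVS_sigma_additive.

Let lebesgue_rVS_sigma_finite : sigma_finite setT lebesgue_rVS.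
Proof.
have /sigma_finiteP[F [TF ndF Foo]] := sigma_finiteT (@lebesgue_measure R).
have /sigma_finiteP[G [TG ndG Goo]] := sigma_finiteT mu.
pose hd (v : 'rV[R]_n.+1) : measurableTypeR R * 'rV[R]_n :=
  (v ord0 ord0, \row_j v ord0 (lift ord0 j)).
have mhd : measurable_fun setT hd.
  apply/measurable_fun_pairP; split; first exact: measurable_coord.
  apply/measurable_fun_coordP => j.
  rewrite (_ : (fun _ => _) = fun v : 'rV[R]_n.+1 => v ord0 (lift ord0 j)).
    exact: measurable_coord.
  by apply/funext => v; rewrite mxE.
exists (fun k => hd @^-1` (F k `*` G k)).
  rewrite -preimage_bigcup; apply/esym; rewrite -subTset => v _.
  have [k _ Fk] : (\bigcup_k F k) (hd v).1 by rewrite -TF.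
  have [l _ Gl] : (\bigcup_k G k) (hd v).2 by rewrite -TG.
  exists (maxn k l) => //; split.
  - by move: Fk; exact/subsetPset/ndF/leq_maxl.
  - by move: Gl; exact/subsetPset/ndG/leq_maxr.
move=> k; have [mF Fk] := Foo k; have [mG Gk] := Goo k; split.
  by rewrite -[X in measurable X]setTI; apply: mhd => //; exact: measurableX.
rewrite /lebesgue_rVS /pushforward -comp_preimage.
rewrite (_ : hd \o _ = id); last first.
  rewrite funeqE => -[x v]; rewrite /hd /= cons_rV0; congr pair.
  by apply/rowP => j; rewrite mxE cons_rVS.
by rewrite preimage_id product_measure1E// lte_mul_pinfty// ge0_fin_numE.
Qed.

HB.instance Definition _ := Measure_isSigmaFinite.Build _ _ _ lebesgue_rVS
  lebesgue_rVS_sigma_finite.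

End lebesgue_rVS.

(* The iterated product of the one-dimensional Lebesgue measure, transported
   along cons_rV; lebesgue_rV_box gives its value on boxes. *)
Fixpoint lebesgue_rV n : {sigma_finite_measure set 'rV[R]_n -> \bar R} :=
  if n is m.+1 then lebesgue_rVS (lebesgue_rV m) else \d_(0 : 'rV[R]_0).

Lemma lebesgue_rV_box n (A : 'I_n -> set (measurableTypeR R)) :
  (forall i, measurable (A i)) ->
  lebesgue_rV n [set v | forall i, A i (v ord0 i)] =
  (\big[*%E/1]_(i < n) lebesgue_measure (A i))%E.
Proof.
elim: n A => [A _|n ih A mA].
  by rewrite big_ord0 /= diracE mem_set// => -[].
rewrite big_ord_recl /= /lebesgue_rVS /pushforward.
rewrite -ih// -product_measure1E//; last first.
  rewrite (_ : (fun _ => _) = \bigcap_(j in [set: 'I_n])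
      ((fun v : 'rV[R]_n => v ord0 j) @^-1` A (lift ord0 j))); last first.
    by apply/seteqP; split=> v /= Av j; [move=> _|]; exact: Av.
  apply: fin_bigcap_measurable => // j _; rewrite -[X in measurable X]setTI.
  by apply: measurable_coord => //; exact: mA.
congr (product_measure1 _ _ _); apply/seteqP; split=> -[x v] /=.
  move=> Av; split=> [|j]; first by have := Av ord0; rewrite cons_rV0.
  by have := Av (lift ord0 j); rewrite cons_rVS.
move=> [Ax Av] i; case: (unliftP ord0 i) => [j|] ->; first by rewrite cons_rVS.
by rewrite cons_rV0.
Qed.

Lemma open_measurable_rV n (U : set 'rV[R]_n) : open U -> measurable U.
Proof.
move=> oU.
pose box (q : 'rV[rat]_n * nat) : set 'rV[R]_n :=
  [set v | forall j, ball (ratr (q.1 ord0 j) : R) q.2.+1%:R^-1 (v ord0 j)].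
have mbox q : measurable (box q).
  rewrite (_ : box q = \bigcap_(j in [set: 'I_n]) ((fun v : 'rV[R]_n =>
      v ord0 j) @^-1` ball (ratr (q.1 ord0 j) : R) q.2.+1%:R^-1)); last first.
    by apply/seteqP; split=> v /= Av j; [move=> _|]; exact: Av.
  apply: fin_bigcap_measurable => // j _; rewrite -[X in measurable X]setTI.
  apply: measurable_coord => //; exact: measurable_ball.
rewrite (_ : U = \bigcup_(q in [set q | box q `<=` U]) box q); last first.
  apply/seteqP; split=> [v Uv|v [q]]; last exact.
  have /nbhs_ballP[e /= e0 eU] := open_nbhs_nbhs (conj oU Uv).
  have [k _ /(_ k (leqnn k)) /= ke] :=
    near_infty_natSinv_lt (PosNum (divr_gt0 e0 (@ltr0Sn R 1))).
  have /choice[f fP] : forall j, exists q : rat,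
      ball (v ord0 j) k.+1%:R^-1 (ratr q : R).
    move=> j; have k0 : 0 < k.+1%:R^-1 :> R by rewrite invr_gt0.
    have b0 : ball (v ord0 j) k.+1%:R^-1 !=set0.
      by exists (v ord0 j); exact: ballxx.
    have [y [vy [q _ qE]]] :=
      @dense_rat R _ b0 (ball_open (v ord0 j) k.+1%:R^-1).
    by exists q; rewrite qE.
  exists (\row_j f j, k) => [w /= vw|j]; last by rewrite mxE; exact/ball_sym.
  apply: eU; split=> // i j; rewrite ord1.
  have := vw j; rewrite /= mxE => /(ball_triangle (fP j)).
  by apply: le_ball; rewrite (splitr e) lerD// ltW.
rewrite bigcup_mkcond; apply: countable_bigcupT_measurable => // q.
by case: ifP.
Qed.

End lebesgue_rV.

Section euclidean.
Context {R : realType} {n : nat}.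
Implicit Types (v x : 'rV[R]_n) (f : 'rV[R]_n -> R) (A : set 'rV[R]_n).

(* The library norm on 'rV[R]_n is the sup norm: it induces the same topology
   and the same bounded sets, but is not the Euclidean norm. *)
Definition enorm v : R := Num.sqrt (\sum_(i < n) v ord0 i ^+ 2).

Definition boundary A : set 'rV[R]_n := closure A `\` A°.

(* For 0 < n and A nonempty and bounded, the infimum is attained
   (dist_boundary_min below). *)
Definition dist_boundary A x : R :=
  inf [set enorm (x - xi) | xi in boundary A].

Definition domain A : Prop := [/\ A !=set0, open A & connected A].

Definition partial (i : 'I_n) f : 'rV[R]_n -> R :=
  fun x => 'D_(delta_mx ord0 i) f x.

Definition gradient f x : 'rV[R]_n := \row_i partial i f x.

(* C^infty, stated through the iterated partial derivatives of all orders;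
   s = [::] is f itself. *)
Definition smooth f : Prop :=
  forall s : seq 'I_n, let g := foldr partial f s in
    continuous g /\ forall i x, derivable g x (delta_mx ord0 i).

Definition support f : set 'rV[R]_n := closure [set x | f x != 0].

(* Functions on Omega are represented by their extension by 0 to the whole
   space. *)
Definition smooth_compact_support A f : Prop :=
  [/\ smooth f, compact (support f) & support f `<=` A].

Lemma enorm_continuous : continuous enorm.
Proof.
have sum_continuous :
    continuous (fun v : 'rV[R]_n => \sum_(i < n) v ord0 i ^+ 2).
  apply: continuous_big => [|i _ v]; first exact: add_continuous.
  apply: (@continuous_comp _ _ _ (fun v : 'rV[R]_n => v ord0 i)
    (fun t => t ^+ 2)); first exact: coord_continuous.
  exact: exprn_continuous.
move=> v; apply: continuous_comp; first exact: sum_continuous.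
exact: sqrt_continuous.
Qed.

Lemma boundary_compact A : bounded_set A -> compact (boundary A).
Proof.
move=> [M [Mreal AM]]; apply: bounded_closed_compact; last first.
  rewrite /boundary setDE; apply: closedI; first exact: closed_closure.
  by apply: open_closedC; exact: open_interior.
exists M; split=> // N MN v -[+ _].
have clN : closed [set v : 'rV[R]_n | `|v| <= N].
  exact: (preimage_closed (fun x _ => @norm_continuous _ _ x) (@closed_le R N)).
have /closureS : A `<=` [set v | `|v| <= N] by move=> w; exact: AM.
by rewrite -((closure_id _).1 clN); exact.
Qed.

Lemma boundary_neq0 A : (0 < n)%N -> A !=set0 -> bounded_set A ->
  boundary A !=set0.
Proof.
move=> n0 [x Ax] [M0 [_ /(_ (M0 + 1)) AM']]; set M := M0 + 1 in AM'.
have AM : forall v, A v -> `|v| <= M by apply: AM'; rewrite ltrDl.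
apply/set0P/negP => /eqP bA0.
have cloA : closure A `<=` A°.
  move=> v clAv; apply: contrapT => iAv.
  by have : boundary A v by []; rewrite bA0.
have oA : open A.
  by move=> v Av; apply: cloA; exact: subset_closure.
have cA : closed A by move=> v /cloA/interior_subset.
pose e : 'rV[R]_n := delta_mx ord0 (Ordinal n0).
have e0 : 0 < `|e|.
  rewrite normr_gt0; apply/eqP => /matrixP/(_ ord0 (Ordinal n0)).
  by rewrite !mxE !eqxx => /eqP; rewrite oner_eq0.
pose f (t : R) : 'rV[R]_n := x + t *: e.
have cf : continuous f.
  by move=> t; apply: cvgD; [exact: cvg_cst|exact: scalel_continuous].
pose T := (`|M| + `|x| + 1) / `|e|.
have T0 : 0 <= T by rewrite divr_ge0// !addr_ge0.
have := @segment_connected _ 0 T (`[0, T] `&` f @^-1` A).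
move=> /(_ _ _ _)/seteqP[|||_ /(_ T)].
- by exists 0; rewrite /= in_itv/= lexx T0 /f scale0r addr0.
- by exists (f @^-1` A) => //; apply: open_comp.
- by exists (f @^-1` A) => //; apply: preimage_closed.
rewrite /= in_itv/= lexx T0 => /(_ isT)[_ /AM] /=; apply/negP.
rewrite -ltNge /f; have : `|T *: e| - `|x| <= `|x + T *: e|.
  rewrite lerBlDr; have := ler_normB (x + T *: e) x.
  by rewrite addrAC subrr add0r.
apply: lt_le_trans; rewrite normrZ (ger0_norm T0) divfK ?gt_eqF//.
by rewrite addrAC addrK (le_lt_trans (ler_norm M))// ltrDl.
Qed.

Lemma dist_boundary_min A x : (0 < n)%N -> A !=set0 -> bounded_set A ->
  exists2 xi, boundary A xi &
    dist_boundary A x = enorm (x - xi) /\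
    forall y, boundary A y -> enorm (x - xi) <= enorm (x - y).
Proof.
move=> n0 A0 bA.
have cd : continuous (fun y : 'rV[R]_n => enorm (x - y)).
  move=> y; apply: (@continuous_comp _ _ _ (fun y : 'rV[R]_n => x - y) enorm).
    by apply: continuousB; [exact: cst_continuous|move=> ?; exact: cvg_id].
  exact: enorm_continuous.
have [xi + xile] := EVT_min_rV (boundary_neq0 n0 A0 bA) (boundary_compact bA)
  (continuous_subspaceT cd).
rewrite inE => bxi; exists xi => //.
have min y : boundary A y -> enorm (x - xi) <= enorm (x - y).
  by move=> bAy; apply: xile; rewrite inE.
split=> //; apply/eqP; rewrite eq_le; apply/andP; split.
  apply: ge_inf; last by exists xi.
  by exists (enorm (x - xi)) => _ [y /min ? <-].
by apply: lb_le_inf; [exists (enorm (x - xi)), xi|move=> _ [y /min ? <-]].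
Qed.

End euclidean.

(* Main.v *)
From HB Require Import structures.
Require Import Defs.
From mathcomp Require Import all_boot all_order all_algebra.
From mathcomp Require Import all_classical all_reals all_analysis.
From mathcomp Require Import measurable_realfun ring lra.
Import Order.TTheory GRing.Theory Num.Theory.
Import numFieldNormedType.Exports.
Local Open Scope classical_set_scope.
Local Open Scope ring_scope.

(** The inequality is reduced to the one-dimensional Hardy inequality
      [\int_S |u t / (t - r)| ^ p <= (p / (p - 1)) ^ p * \int_S |u' t| ^ p]
    for [u] vanishing near [r] and [S] an interval issued from [r]
    ([hardy_right], [hardy_left]).  That one holds because, by Young's
    inequality, the difference of the two integrands is at least a multiple of
    the derivative of [|u| ^ p * |t - r| ^ (1 - p)], which vanishes near [r]
    and is nonnegative at the other end.

    A convex domain is the intersection of its supporting half-spaces, and the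
    distance to its boundary is the infimum of the distances to the supporting
    hyperplanes; countably many normals are enough ([slab_dist_dense]).  For
    finitely many of them, cut the polyhedron they define into the pieces where
    a given face is the nearest one.  Such a piece contains, with each point,
    the segment towards that face along its normal ([slab_piece_star]).  The
    one-dimensional inequality on all lines parallel to the normal therefore
    gives the inequality on the piece, for the distance to the face
    ([hardy_halfspace]), since the derivative of the function along a unit
    vector is at most the norm of its gradient.  Summing over the pieces gives
    the inequality for the polyhedron ([hardy_slab_min]), and letting the number
    of half-spaces grow gives it for the domain ([hardy_convex]).

    Slicing along an arbitrary direction [w] with first coordinate 1 only takes
    Tonelli's theorem and translation invariance ([slanted_tonelli]); for this
    reason the countably many normals are chosen with nonzero first coordinate. *)

Set Implicit Arguments.
Unset Strict Implicit.
Unset Printing Implicit Defensive.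

(** * The one-dimensional Hardy inequality *)

(** Away from the origin this is a composition of continuous functions; at the
    origin it is squeezed between 0 and [`|x|], because [1 < p]. *)
Lemma powR_norm_continuous (R : realType) (p : R) : 1 < p ->
  continuous (fun x : R => `|x| `^ p).
Proof.
move=> p1 x; have [->|x0] := eqVneq x 0; last first.
  apply: (@continuous_comp _ _ _ (fun x : R => `|x|) (fun x => x `^ p)).
    exact: norm_continuous.
  apply: differentiable_continuous; apply/derivable1_diffP.
  by apply: derivable_powR; rewrite in_itv/= andbT normr_gt0.
rewrite /continuous_at normr0 powR0; last by rewrite gt_eqF// (lt_trans ltr01).
apply: (@squeeze_cvgr _ _ _ _ (fun _ => 0) (fun x : R => `|x|)).
- near=> y; rewrite powR_ge0/=.
  have y1 : `|y| <= 1.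
    near: y; apply/nbhs_ballP; exists 1 => //= z.
    by rewrite /ball/= sub0r normrN => /ltW.
  have [->|y0] := eqVneq y 0.
    by rewrite normr0 powR0// gt_eqF// (lt_trans ltr01).
  rewrite -[leRHS]powRr1//; apply: ger_powR; last exact: ltW.
  by rewrite normr_gt0 y0.
- exact: cvg_cst.
- by rewrite -[X in _ --> X](@normr0 _ R); exact: norm_continuous.
Unshelve. all: by end_near. Qed.

Lemma is_derive1_continuous (R : realType) (f df : R -> R) :
  (forall t : R, is_derive t 1 f (df t)) -> continuous f.
Proof.
move=> d t; apply: differentiable_continuous; apply/derivable1_diffP.
by have [] := d t.
Qed.

(** Young's inequality for the conjugate exponents [p] and [q = p / (p - 1)],
    applied to [q * b] and [a ^ (p - 1)].  For [a = V / (t - r)] and [b = V'] the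
    bracket is the derivative of [V ^ p * (t - r) ^ (1 - p)], so that up to a
    total derivative [a ^ p] is controlled by [b ^ p], with the sharp constant. *)
Lemma hardy_young (R : realType) (p a b : R) : 1 < p -> 0 <= a -> 0 <= b ->
  a `^ p + p / (p - 1) * (p * a `^ (p - 1) * b - (p - 1) * a `^ p)
    <= (p / (p - 1)) `^ p * b `^ p.
Proof.
move=> p1 a0 b0.
have p0 : 0 < p by rewrite (lt_trans ltr01).
have q0 : 0 < p - 1 by rewrite subr_gt0.
set q := p / (p - 1).
have Q0 : 0 < q by rewrite divr_gt0.
have pq : p^-1 + q^-1 = 1.
  by rewrite /q invf_div; field; rewrite gt_eqF.
have := @conjugate_powR _ (q * b) (a `^ (p - 1)) p q.
rewrite mulr_ge0 ?powR_ge0 ?(ltW Q0)// => /(_ isT isT p0 Q0 pq).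
rewrite -powRrM /q mulrC.
have -> : (p - 1) * (p / (p - 1)) = p by field; rewrite gt_eqF.
rewrite -/q powRM ?(ltW Q0)// => H.
have {}H := ler_wpM2l (ltW p0) H.
have E1 : q * (p * a `^ (p - 1) * b) = p * (a `^ (p - 1) * (q * b)) by ring.
rewrite mulrBr E1.
apply: le_trans (_ : a `^ p + (p * (q `^ p * b `^ p / p + a `^ p / q) - q * ((p - 1) * a `^ p)) <= _).
  by rewrite lerD2l lerD2r.
rewrite le_eqVlt; apply/orP; left; apply/eqP.
by rewrite /q; field; rewrite !gt_eqF.
Qed.

Section hardy_segment.
Context (R : realType) (p : R) (p1 : 1 < p).
Local Notation mu := (@lebesgue_measure R).
Variables (u g : R -> R) (r a T : R).
Hypotheses (du : forall t : R, is_derive t 1 u (g t)) (cg : continuous g).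
Hypotheses (ra : r < a) (aT : a < T) (ua : u a = 0).

Let p0 : 0 < p. Proof. by rewrite (lt_trans ltr01). Qed.
Let pm0 : 0 < p - 1. Proof. by rewrite subr_gt0. Qed.
Let q := p / (p - 1).
Let q0 : 0 < q. Proof. by rewrite divr_gt0. Qed.

Let cu : continuous u := is_derive1_continuous du.

Let within_cont (f : R -> R) : (forall t, r < t -> {for t, continuous f}) ->
  {within `[a, T], continuous f}.
Proof.
move=> cf; apply: continuous_in_subspaceT => t; rewrite inE/= in_itv/= => /andP[at_ _].
by apply: cf; rewrite (lt_le_trans ra).
Qed.

Let integrable_cont (f : R -> R) :
  (forall t, r < t -> {for t, continuous f}) ->
  mu.-integrable `[a, T] (EFin \o f).
Proof.
move=> cf; apply: continuous_compact_integrable; first exact: segment_compact.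
exact: within_cont.
Qed.

Let ig : mu.-integrable `[a, T] (EFin \o (fun t => `|g t| `^ p)).
Proof.
apply: integrable_cont => t _.
apply: (@continuous_comp _ _ _ g (fun x => `|x| `^ p)); first exact: cg.
exact: powR_norm_continuous.
Qed.

Let iu : mu.-integrable `[a, T] (EFin \o (fun t => `|u t / (t - r)| `^ p)).
Proof.
apply: integrable_cont => t rt.
apply: (@continuous_comp _ _ _ (fun t => u t / (t - r)) (fun x => `|x| `^ p)).
  apply: cvgM; first exact: cu.
  apply: cvgV; first by rewrite gt_eqF// subr_gt0.
  by apply: cvgB; [exact: cvg_id|exact: cvg_cst].
exact: powR_norm_continuous.
Qed.

(* The regularization V = sqrt (u ^ 2 + e ^ 2) is positive, so that V ^ p is
   differentiable, and satisfies |u| <= V, |V'| <= |u'| and V a = e. *)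
Section regularized.
Variables (e : R) (e0 : 0 < e).
Let W t := u t ^+ 2 + e ^+ 2.
Let V t := W t `^ (2^-1).
Let W0 t : 0 < W t.
Proof. by rewrite ltr_wpDl ?sqr_ge0// exprn_gt0. Qed.
Let V0 t : 0 < V t. Proof. exact: powR_gt0. Qed.
Let VV t : V t ^+ 2 = W t.
Proof. by rewrite -powR_mulrn ?(ltW (V0 t))// -powRrM mulVf// powRr1// ltW. Qed.

Let dW (t : R) : is_derive t 1 W (2 * u t * g t).
Proof.
have := is_deriveD (is_deriveX 2 (du t)) (is_derive_cst (e ^+ 2 : R) t 1).
move/is_derive_eq; apply.
by rewrite addr0 /GRing.scale/= expr1.
Qed.

Let dV (t : R) : is_derive t 1 V (u t * g t / V t).
Proof.
rewrite /V.
have dw := dW t.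
have dp : is_derive (W t) 1 (@powR R ^~ 2^-1) (2^-1 * W t `^ (2^-1 - 1)).
  exact: is_derive1_powR.
have := @is_derive1_comp _ (@powR R ^~ 2^-1) W t _ _ dp dw.
move/is_derive_eq; apply.
have -> : 2^-1 - 1 = - 2^-1 :> R by field.
rewrite powRN; field; by rewrite gt_eqF// V0.
Qed.

Let phi t := V t `^ p * (t - r) `^ (1 - p).
Let dphi t := p * (V t / (t - r)) `^ (p - 1) * (u t * g t / V t)
   - (p - 1) * (V t / (t - r)) `^ p.

Let isdphi (t : R) : r < t -> is_derive t 1 phi (dphi t).
Proof.
move=> rt; have tr : 0 < t - r by rewrite subr_gt0.
have d1 : is_derive t 1 (fun t => V t `^ p) ((p * V t `^ (p - 1)) * (u t * g t / V t)).
  have dv := dV t.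
  have dp : is_derive (V t) 1 (@powR R ^~ p) (p * V t `^ (p - 1)).
    exact: is_derive1_powR.
  exact: (@is_derive1_comp _ (@powR R ^~ p) V t _ _ dp dv).
have d2 : is_derive t 1 (fun t => (t - r) `^ (1 - p)) ((1 - p) * (t - r) `^ (- p)).
  have dp : is_derive (t - r) 1 (@powR R ^~ (1 - p)) ((1 - p) * (t - r) `^ (1 - p - 1)).
    exact: is_derive1_powR.
  have ds : is_derive t 1 (shift (- r)) (1 : R) by exact: is_derive_shift.
  have := @is_derive1_comp _ (@powR R ^~ (1 - p)) (shift (- r)) t _ _ dp ds.
  by move/is_derive_eq; apply; rewrite mulr1 addrAC subrr add0r.
have := is_deriveM d1 d2.
move/is_derive_eq; apply.
rewrite /dphi /GRing.scale/= !powRM ?invr_ge0 ?(ltW tr) ?(ltW (V0 t))//.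
have inv k : (t - r)^-1 `^ k = (t - r) `^ (- k).
  by rewrite -powR_inv1 ?(ltW tr)// -powRrM mulN1r.
rewrite !inv opprB.
have -> : V t `^ p = V t `^ (p - 1) * V t.
  by rewrite mulrC mulr_powRB1 // ltW.
by ring.
Qed.

Let cdphi (t : R) : r < t -> {for t, continuous dphi}.
Proof.
move=> rt; have tr : 0 < t - r by rewrite subr_gt0.
have cV : {for t, continuous V}.
  exact: (is_derive1_continuous dV).
have cVr : {for t, continuous (fun t => V t / (t - r))}.
  apply: cvgM => //; apply: cvgV; first by rewrite gt_eqF.
  by apply: cvgB; [exact: cvg_id|exact: cvg_cst].
have cpow k : {for t, continuous (fun t => (V t / (t - r)) `^ k)}.
  apply: (@continuous_comp _ _ _ (fun t => V t / (t - r)) (@powR R ^~ k)) => //.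
  apply: differentiable_continuous; apply/derivable1_diffP.
  by apply: derivable_powR; rewrite in_itv/= andbT divr_gt0// V0.
apply: cvgB; apply: cvgM.
- by apply: cvgM; [exact: cvg_cst|exact: cpow].
- apply: cvgM; last by apply: cvgV; rewrite ?gt_eqF// V0.
  by apply: cvgM; [exact: cu|exact: cg].
- exact: cvg_cst.
- exact: cpow.
Qed.

Let gap t : r < t ->
  q * dphi t <= q `^ p * `|g t| `^ p - `|u t / (t - r)| `^ p.
Proof.
move=> rt; have tr : 0 < t - r by rewrite subr_gt0.
have uV : `|u t| <= V t.
  rewrite -(@ler_pXn2r _ 2) ?nnegrE ?(ltW (V0 t))//.
  by rewrite VV real_normK ?num_real// lerDl sqr_ge0.
have A0 : 0 <= V t / (t - r) by rewrite divr_ge0 ?(ltW (V0 t))// ltW.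
have := hardy_young p1 A0 (normr_ge0 (g t)); rewrite -/q.
rewrite lerBrDl; apply: le_trans; apply: lerD.
  apply: ge0_ler_powR; rewrite ?nnegrE ?(ltW p0)//.
  by rewrite normrM normfV (gtr0_norm tr) ler_pM2r// invr_gt0.
rewrite ler_pM2l// lerD2r// ler_wpM2l//.
  by rewrite mulr_ge0 ?powR_ge0// ltW.
rewrite ler_pdivrMr ?V0// (le_trans (ler_norm _))// normrM mulrC.
by rewrite ler_wpM2l.
Qed.

(** Integrating [gap] over [a, T]: the primitive [phi] contributes a
    nonnegative term at [T], which is dropped, and the error term at [a]. *)
Lemma hardy_segment_regularized :
  \int[mu]_(t in `[a, T]) (`|u t / (t - r)| `^ p) <=
  q `^ p * (\int[mu]_(t in `[a, T]) (`|g t| `^ p)) +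
   q * (e `^ p * (a - r) `^ (1 - p)).
Proof.
have iphi : mu.-integrable `[a, T] (EFin \o dphi) by exact: integrable_cont.
have FTC : \int[mu]_(t in `[a, T]) dphi t = phi T - phi a.
  rewrite /Rintegral (@continuous_FTC2 _ dphi phi)//.
  - exact: within_cont.
  - have dphia t : a <= t -> derivable phi t 1.
      by move=> at_; have [] := isdphi (lt_le_trans ra at_).
    have cphi t : a <= t -> {for t, continuous phi}.
      by move=> /dphia/derivable1_diffP/differentiable_continuous.
    split.
    + by move=> t; rewrite in_itv/= => /andP[/ltW/dphia].
    + by apply: cvg_at_right_filter; exact: cphi.
    + by apply: cvg_at_left_filter; apply: cphi; exact: ltW.
  - move=> t; rewrite in_itv/= => /andP[at_ _]; rewrite derive1E.
    by have [] := isdphi (lt_trans ra at_).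
have : \int[mu]_(t in `[a, T]) (q * dphi t) <=
       \int[mu]_(t in `[a, T]) (q `^ p * `|g t| `^ p - `|u t / (t - r)| `^ p).
  apply: le_Rintegral => //.
  - exact: (integrableZl _ q iphi).
  - exact: (integrableB _ (integrableZl _ (q `^ p) ig) iu).
  - move=> t; rewrite /= in_itv/= => /andP[at_ _]; apply: gap.
    exact: lt_le_trans at_.
rewrite RintegralZl// FTC RintegralB//; last exact: (integrableZl _ (q `^ p) ig).
rewrite RintegralZl//.
have phiT : 0 <= q * phi T by rewrite mulr_ge0 ?(ltW q0)// mulr_ge0 ?powR_ge0.
have -> : e `^ p * (a - r) `^ (1 - p) = phi a.
  rewrite /phi /V /W ua expr0n/= add0r -powR_mulrn ?(ltW e0)// -!powRrM ?mulrA.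
  by rewrite mulfV// mul1r.
rewrite mulrBr lerBrDl -lerBrDr => /le_trans; apply.
by rewrite opprB lerD2l lerBlDr lerDl.
Qed.
End regularized.

Lemma hardy_segment :
  (\int[mu]_(t in `[a, T]) (`|u t / (t - r)| `^ p)%:E <=
   (q `^ p)%:E * \int[mu]_(t in `[a, T]) (`|g t| `^ p)%:E)%E.
Proof.
rewrite -[leLHS]fineK; last exact: integrable_fin_num iu.
rewrite -[X in (_ * X)%E]fineK; last exact: integrable_fin_num ig.
rewrite -EFinM lee_fin; apply/ler_addgt0Pr => e e0.
have ar0 : 0 < (a - r) `^ (1 - p) by rewrite powR_gt0// subr_gt0.
pose k := q * (a - r) `^ (1 - p).
have k0 : 0 < k by rewrite mulr_gt0.
(* this regularization makes the error term equal to e *)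
have := @hardy_segment_regularized ((e / k) `^ p^-1).
rewrite powR_gt0 ?divr_gt0// => /(_ isT).
rewrite -powRrM mulVf ?gt_eqF// powRr1; last by rewrite ltW// divr_gt0.
suff -> : q * (e / k * (a - r) `^ (1 - p)) = e by [].
by rewrite mulrCA -/k divfK// gt_eqF.
Qed.
End hardy_segment.

Lemma measurable_normr_powR (R : realType) d (X : measurableType d)
    (D : set X) (f : X -> R) (p : R) :
  measurable_fun D f -> measurable_fun D (fun x => (`|f x| `^ p)%:E).
Proof.
move=> mf; apply/measurable_EFinP.
by apply: (@measurableT_comp _ _ _ _ _ _ (@powR R ^~ p)) => //; exact: measurableT_comp.
Qed.

(** Powers of exponent -1 are measurable on the whole line, and turn the quotient
    into a product. *)
Lemma measurable_normr_div_powR (R : realType) d (X : measurableType d)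
    (D : set X) (f g : X -> R) (p : R) :
  measurable_fun D f -> measurable_fun D g ->
  measurable_fun D (fun x => (`|f x / g x| `^ p)%:E).
Proof.
move=> mf mg; apply/measurable_EFinP.
rewrite (_ : (fun x => _) = (fun x => (`|f x| * `|g x| `^ (-1)) `^ p)); last first.
  by apply/funext => x; rewrite normrM normfV -powR_inv1.
apply: (@measurableT_comp _ _ _ _ _ _ (@powR R ^~ p)) => //.
apply: measurable_funM; first exact: measurableT_comp.
apply: (@measurableT_comp _ _ _ _ _ _ (@powR R ^~ (-1))) => //.
exact: measurableT_comp.
Qed.

Section hardy_halfline.
Context (R : realType) (p : R) (p1 : 1 < p).
Local Notation mu := (@lebesgue_measure R).
Local Notation q := (p / (p - 1)).
Local Open Scope ereal_scope.

(** From compact intervals: a right endpoint is negligible, and monotone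
    convergence gives the unbounded interval. *)
Lemma hardy_itv (u g : R -> R) (r a : R) :
  (forall t : R, is_derive t (1%R : R) u (g t)) -> continuous g ->
  (r < a)%R -> u a = 0%R -> forall b : itv_bound R,
  \int[mu]_(t in [set` Interval (BLeft a) b]) (`|u t / (t - r)| `^ p)%:E <=
  (q `^ p)%:E * \int[mu]_(t in [set` Interval (BLeft a) b]) (`|g t| `^ p)%:E.
Proof.
move=> du cg ra ua.
have cu := is_derive1_continuous du.
pose f t := (`|u t / (t - r)| `^ p)%:E; pose h t := (`|g t| `^ p)%:E.
have mf : measurable_fun setT f.
  apply: measurable_normr_div_powR; first exact: continuous_measurable_fun.
  exact: measurable_funB.
have mh : measurable_fun setT h.
  by apply: measurable_normr_powR; exact: continuous_measurable_fun.
have f0 t : 0 <= f t by rewrite lee_fin powR_ge0.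
have h0 t : 0 <= h t by rewrite lee_fin powR_ge0.
have q0 : 0 <= (q `^ p)%:E by rewrite lee_fin powR_ge0.
have seg T : \int[mu]_(t in `[a, T]) f t <= (q `^ p)%:E * \int[mu]_(t in `[a, T]) h t.
  have [aT|] := ltP a T; first exact: hardy_segment.
  rewrite le_eqVlt => /predU1P[->|Ta]; last first.
    by rewrite set_itv_ge ?bnd_simp -?ltNge// !integral_set0 mule0.
  by rewrite set_itv1 !integral_set1 mule0.
case=> [[] b|[]].
- rewrite !integral_itv_bndo_bndc; first exact: seg.
  + exact: measurable_funTS.
  + exact: measurable_funTS.
- exact: seg.
- by rewrite set_itv_ge ?bnd_simp// !integral_set0 mule0.
- have E (k : R -> \bar R) : (forall t, 0 <= k t) -> measurable_fun setT k ->
     \int[mu]_(t in `[a, (a + n%:R)%R]) k t @[n --> \oo] -->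
     \int[mu]_(t in `[a, +oo[) k t.
    move=> k0 mk; rewrite itv_bndy_bigcup_BRight.
    apply: ge0_nondecreasing_set_cvg_integral => //.
    + move=> m n mn; rewrite subsetEset; apply: subset_itvl.
      by rewrite bnd_simp lerD2l ler_nat.
    + by move=> n; exact: measurable_funTS.
  have H := E _ f0 mf; rewrite -(cvg_lim _ H)//.
  apply: lime_le; first by apply/cvg_ex; eexists; exact: H.
  apply: nearW => n; apply: le_trans (seg _) _; apply: lee_wpmul2l => //.
  apply: ge0_subset_integral => //; first exact: measurable_funTS.
  by apply: subset_itvl; rewrite bnd_simp.
Qed.

(** Downward closedness towards [r] makes [S], up to the part where [u]
    vanishes, an interval starting at [a], possibly unbounded. *)
Lemma hardy_right (u g : R -> R) (r a : R) (S : set R) :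
  (forall t : R, is_derive t (1%R : R) u (g t)) -> continuous g ->
  (r < a)%R -> (forall t, r <= t <= a -> u t = 0)%R ->
  measurable S -> (forall t, S t -> r < t)%R ->
  (forall s t, r < s <= t -> S t -> S s)%R ->
  \int[mu]_(t in S) (`|u t / (t - r)| `^ p)%:E <=
  (q `^ p)%:E * \int[mu]_(t in S) (`|g t| `^ p)%:E.
Proof.
move=> du cg ra ura mS Sr Sstar.
have cu := is_derive1_continuous du.
pose S' := S `&` `[a, +oo[.
have -> : \int[mu]_(t in S) (`|u t / (t - r)| `^ p)%:E =
          \int[mu]_(t in S') (`|u t / (t - r)| `^ p)%:E.
  rewrite integral_mkcondr; apply: eq_integral => t; rewrite inE => St.
  rewrite patchE; case: ifPn => //; rewrite notin_setE/= in_itv/= andbT => /negP.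
  rewrite -ltNge => ta; rewrite ura ?mul0r ?normr0 ?powR0//.
    by rewrite gt_eqF// (lt_trans ltr01).
  by rewrite !ltW// Sr.
have S'S : \int[mu]_(t in S') (`|g t| `^ p)%:E <= \int[mu]_(t in S) (`|g t| `^ p)%:E.
  apply: ge0_subset_integral => //; first exact: measurableI.
    apply: measurable_normr_powR; apply: measurable_funTS.
    exact: continuous_measurable_fun.
  exact: subIsetl.
apply: le_trans (lee_wpmul2l _ S'S); last by rewrite lee_fin powR_ge0.
have [S'0|/set0P[t0 S't0]] := eqVneq S' set0.
  by rewrite S'0 !integral_set0 mule0.
have [b ->] : exists b, S' = [set` Interval (BLeft a) b].
  have S'a t : S' t -> (a <= t)%R by move=> [_]; rewrite /= in_itv/= andbT.
  have S'star s t : (a <= s)%R -> (s <= t)%R -> S' t -> S' s.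
    move=> as_ st [St _]; split; last by rewrite /= in_itv/= andbT.
    by apply: Sstar St; rewrite st (lt_le_trans ra).
  have [ubS|nubS] := pselect (has_ubound S'); last first.
    exists +oo%O; apply/seteqP; split=> [t /S'a|t]; rewrite /= in_itv/= andbT//.
    move=> at_; apply: contrapT => nS't; apply: nubS; exists t => s S's.
    by rewrite leNgt; apply/negP => /ltW ts; exact/nS't/(S'star _ s).
  have supS : has_sup S' by split => //; exists t0.
  have [S'sup|nS'sup] := pselect (S' (sup S')).
    exists (BRight (sup S')); apply/seteqP; split=> t; rewrite /= in_itv/=.
      by move=> S't; rewrite S'a//=; exact: sup_ubound.
    by move=> /andP[at_ tS]; exact: S'star S'sup.
  exists (BLeft (sup S')); apply/seteqP; split=> t; rewrite /= in_itv/=.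
    move=> S't; rewrite S'a//= lt_neqAle sup_ubound// andbT.
    by apply/eqP => tE; apply: nS'sup; rewrite -tE.
  move=> /andP[at_ tS]; have [s S's ts] := sup_gt supS.1 tS.
  exact: S'star (ltW ts) S's.
by apply: hardy_itv => //; apply: ura; rewrite lexx andbT ltW.
Qed.

(** The mirror image of [hardy_right], by the invariance of the Lebesgue measure
    under [t |-> - t]. *)
Lemma hardy_left (u g : R -> R) (r a : R) (S : set R) :
  (forall t : R, is_derive t (1%R : R) u (g t)) -> continuous g ->
  (a < r)%R -> (forall t, a <= t <= r -> u t = 0)%R ->
  measurable S -> (forall t, S t -> t < r)%R ->
  (forall s t, t <= s < r -> S t -> S s)%R ->
  \int[mu]_(t in S) (`|u t / (t - r)| `^ p)%:E <=
  (q `^ p)%:E * \int[mu]_(t in S) (`|g t| `^ p)%:E.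
Proof.
move=> du cg ar uar mS Sr Sstar.
have cu := is_derive1_continuous du.
have mN : measurable_fun setT (-%R : measurableTypeR R -> measurableTypeR R).
  exact: oppr_measurable.
have refl (k : R -> \bar R) : (forall t, 0 <= k t) -> measurable_fun setT k ->
    \int[mu]_(t in S) k t = \int[mu]_(t in -%R @^-1` S) k (- t)%R.
  move=> k0 mk.
  rewrite -(@ge0_integral_pushforward _ _ (measurableTypeR R) (measurableTypeR R)
    R _ mN mu S)//.
  - by apply: eq_measure_integral => A mA _; exact/esym/lebesgue_measureN.
  - exact: measurable_funTS.
rewrite !refl//; last 2 first.
- by apply: measurable_normr_powR; exact: continuous_measurable_fun.
- apply: measurable_normr_div_powR; first exact: continuous_measurable_fun.
  exact: measurable_funB.
have := @hardy_right (fun t => u (- t)%R) (fun t => - g (- t))%R (- r) (- a) (-%R @^-1` S).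
under [X in (_ -> _ -> _ -> _ -> _ -> _ -> _ -> X <= _) -> _]eq_integral do
  rewrite opprK -normrN -mulrN -invrN opprD.
under [X in (_ -> _ -> _ -> _ -> _ -> _ -> _ -> _ <= _ * X) -> _]eq_integral do
  rewrite normrN.
apply.
- move=> t; have ds : is_derive t (1%R : R) (-%R : R -> R) (-1)%R by exact: is_deriveNid.
  have := @is_derive1_comp _ u (-%R) t _ _ (du (- t)%R) ds.
  by move/is_derive_eq; apply; rewrite mulrN1.
- move=> t; apply: continuousN; apply: continuous_comp; last exact: cg.
  exact: continuousN.
- by rewrite ltrN2.
- by move=> t /andP[rt ta]; apply: uar; rewrite lerNr ta lerNl.
- by rewrite -[X in measurable X]setTI; exact: mN.
- by move=> t /Sr; rewrite ltrNl.
- by move=> s t /andP[rs st]; apply: Sstar; rewrite lerN2 st ltrNl.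
Qed.
End hardy_halfline.

(** * Integration along parallel lines *)

Section slanted_tonelli.
Context {R : realType}.
Local Notation mu := (@lebesgue_measure R).
Local Open Scope ereal_scope.

Lemma lebesgue_measure_shift (c : R) (A : set R) : measurable A ->
  pushforward mu (shift c : _ -> measurableTypeR R) A = mu A.
Proof.
move=> mA; have ms : measurable_fun setT (shift c : measurableTypeR R -> measurableTypeR R).
  exact: measurable_funD.
pose shift_mfun : {mfun measurableTypeR R >-> measurableTypeR R} :=
  HB.pack (shift c : measurableTypeR R -> measurableTypeR R)
    (isMeasurableFun.Build _ _ _ _ _ ms).
apply/esym.
apply: (@lebesgue_measure_unique R (pushforward mu shift_mfun)) => //= _ [[a b]] _ <-.
rewrite /pushforward/= (_ : _ @^-1` _ = `](a - c)%R, (b - c)%R]%classic); last first.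
  apply/seteqP; split=> t; rewrite /= !in_itv/= -ltrBlDr -lerBrDr//.
rewrite !lebesgue_measure_itv/= !lte_fin ltrD2r; case: ifP => // _.
by rewrite -!EFinB; congr EFin; lra.
Qed.

Lemma ge0_integral_shift (c : R) (f : R -> \bar R) :
  measurable_fun setT f -> (forall t, 0 <= f t) ->
  \int[mu]_t f (t + c)%R = \int[mu]_t f t.
Proof.
move=> mf f0.
have ms : measurable_fun setT (shift c : measurableTypeR R -> measurableTypeR R).
  exact: measurable_funD.
rewrite -[LHS](@ge0_integral_pushforward _ _ (measurableTypeR R) (measurableTypeR R)
    R _ ms mu setT f)//.
by apply: eq_measure_integral => A mA _; exact: lebesgue_measure_shift.
Qed.

Lemma measurable_shift_rV n (v : 'rV[R]_n) :
  measurable_fun setT (fun x : 'rV[R]_n => (x + v)%R).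
Proof.
apply/measurable_fun_coordP => i.
rewrite (_ : (fun x => _) = (fun x : 'rV[R]_n => x ord0 i + v ord0 i)%R).
  by apply: measurable_funD => //; exact: measurable_coord.
by apply/funext => x; rewrite mxE.
Qed.

Lemma tonelli_rVS n (f : 'rV[R]_n.+1 -> \bar R) :
  measurable_fun setT f -> (forall x, 0 <= f x) ->
  \int[lebesgue_rV n.+1]_x f x =
  \int[mu]_t \int[lebesgue_rV n]_y f (cons_rV (t, y)).
Proof.
move=> mf f0.
rewrite [LHS](@ge0_integral_pushforward _ _ _ _ _ _ (@measurable_cons_rV R n) _ setT f)//.
rewrite preimage_setT (fubini_tonelli1 (f \o @cons_rV R n))//.
  by apply: measurableT_comp => //; exact: measurable_cons_rV.
by move=> z; exact: f0.
Qed.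

(** By induction on the dimension: translate the last coordinates inside the
    iterated integral, then the first one. *)
Lemma integral_translation_rV n (v : 'rV[R]_n) (f : 'rV[R]_n -> \bar R) :
  measurable_fun setT f -> (forall x, 0 <= f x) ->
  \int[lebesgue_rV n]_x f (x + v)%R = \int[lebesgue_rV n]_x f x.
Proof.
elim: n v f => [|n ih] v f mf f0.
  by apply: eq_integral => x _; congr f; rewrite (thinmx0 v) addr0.
have mfv : measurable_fun setT (fun x : 'rV[R]_n.+1 => f (x + v)%R).
  by apply: measurableT_comp => //; exact: measurable_shift_rV.
apply: (etrans (tonelli_rVS mfv _)) => [x|]; first exact: f0.
apply/esym/(etrans (tonelli_rVS mf f0))/esym.
pose F t := \int[lebesgue_rV n]_y f (cons_rV (t, y)).
have mF : measurable_fun setT F.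
  apply: (measurable_fun_fubini_tonelli_F (f \o @cons_rV R n)).
    by apply: measurableT_comp => //; exact: measurable_cons_rV.
  by move=> z; exact: f0.
transitivity (\int[mu]_t F (t + v ord0 ord0)%R); last first.
  by apply: ge0_integral_shift => // t; exact: integral_ge0.
apply: eq_integral => t _; rewrite /F.
rewrite -[RHS](ih (\row_j v ord0 (lift ord0 j)))//; last first.
  apply: measurableT_comp => //.
  apply: (measurableT_comp (@measurable_cons_rV R n)).
  exact: pair1_measurable.
apply: eq_integral => y _; congr f; apply/rowP => i; rewrite !mxE.
by case: unliftP => [j|] ->; rewrite /= ?mxE.
Qed.

Lemma measurable_slanted_pair n (w : 'rV[R]_n.+1) (f : 'rV[R]_n.+1 -> \bar R) :
  measurable_fun setT f ->
  measurable_fun setT (fun z : measurableTypeR R * 'rV[R]_n =>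
    f (cons_rV (0%R, z.2) + z.1 *: w)%R).
Proof.
move=> mf; apply: measurableT_comp => //; apply/measurable_fun_coordP => i.
rewrite (_ : (fun z => _) = (fun z : measurableTypeR R * 'rV[R]_n =>
   cons_rV (0%R, z.2) ord0 i + z.1 * w ord0 i)%R); last first.
  by apply/funext => z; rewrite !mxE.
apply: measurable_funD; last exact: measurable_funM.
apply: (measurableT_comp (@measurable_coord _ _ _ i)).
apply: (measurableT_comp (@measurable_cons_rV R n)).
by apply/measurable_fun_pairP; split; [exact: measurable_cst|exact: measurable_snd].
Qed.

Lemma measurable_slanted n (w : 'rV[R]_n.+1) (f : 'rV[R]_n.+1 -> \bar R) :
  measurable_fun setT f -> (forall x, 0 <= f x) ->
  measurable_fun setT (fun y => \int[mu]_t f (cons_rV (0%R, y) + t *: w)%R).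
Proof.
move=> mf f0.
have mg := measurable_slanted_pair w mf.
by apply: (measurable_fun_fubini_tonelli_G _ mg) => z.
Qed.

(** Tonelli's theorem along the lines of direction [w].  Once the first
    coordinate [t] is fixed, moving along [w] only translates the remaining
    coordinates by [t] times those of [w]; since [w] has first coordinate 1 the
    shear has Jacobian 1, and no general change of variables is needed. *)
Lemma slanted_tonelli n (w : 'rV[R]_n.+1) (f : 'rV[R]_n.+1 -> \bar R) :
  w ord0 ord0 = 1%R -> measurable_fun setT f -> (forall x, 0 <= f x) ->
  \int[lebesgue_rV n.+1]_x f x =
  \int[lebesgue_rV n]_y \int[mu]_t f (cons_rV (0%R, y) + t *: w)%R.
Proof.
move=> w0 mf f0.
pose g (z : measurableTypeR R * 'rV[R]_n) := f (cons_rV (0%R, z.2) + z.1 *: w)%R.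
have mg : measurable_fun setT g by exact: measurable_slanted_pair.
have g0 z : 0 <= g z by exact: f0.
apply: (etrans (tonelli_rVS mf f0)); apply/esym/(etrans (esym (fubini_tonelli g mg g0)))/esym.
apply: eq_integral => t _.
rewrite -[LHS](@integral_translation_rV n (t *: \row_j w ord0 (lift ord0 j)))//; last first.
  apply: measurableT_comp => //.
  apply: (measurableT_comp (@measurable_cons_rV R n)).
  exact: pair1_measurable.
apply: eq_integral => y _; congr f; apply/rowP => i; rewrite !mxE/=.
by case: unliftP => [j|] ->; rewrite /= ?mxE ?w0 ?mulr1 ?add0r.
Qed.

End slanted_tonelli.

(** * Directional derivatives *)

Section directional_derivatives.
Context {R : realType} {n : nat}.
Implicit Types (f : 'rV[R]_n -> R) (v w x y : 'rV[R]_n).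

Lemma is_derive_line f y w (t d : R) :
  is_derive (y + t *: w) w f d <-> is_derive t 1 (fun s => f (y + s *: w)) d.
Proof.
have E : (fun h => h^-1 *: (((fun s => f (y + s *: w)) \o shift t) (h *: 1)
             - f (y + t *: w))) =
         (fun h => h^-1 *: ((f \o shift (y + t *: w)) (h *: w) - f (y + t *: w))).
  apply/funext => h /=; congr (_ *: (f _ - _)).
  by rewrite addrCA -scalerDl [h *: 1]mulr1.
split=> -[df <-]; split.
- by rewrite /derivable E.
- by rewrite /derive E.
- by rewrite /derivable -E.
- by rewrite /derive -E.
Qed.

Lemma is_derive_scale f x v (k d : R) :
  is_derive x v f d -> is_derive x (k *: v) f (k * d).
Proof.
have E0 z : x = x + 0 *: z by rewrite scale0r addr0.
rewrite {1}(E0 v) => /is_derive_line dv.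
rewrite {1}(E0 (k *: v)); apply/is_derive_line.
have dk : is_derive (0 : R) 1 ( *%R k) k.
  by have := is_deriveZ k (is_derive_id (0 : R) (1 : R)) => /is_derive_eq; apply; rewrite [_ *: _]mulr1.
rewrite -(mulr0 k) in dv.
have := @is_derive1_comp _ (fun s => f (x + s *: v)) ( *%R k) 0 _ _ dv dk.
rewrite (_ : _ \o _ = (fun s => f (x + s *: (k *: v)))); last first.
  by apply/funext => s /=; rewrite scalerA mulrC.
by rewrite mulrC.
Qed.

Lemma mvt_line f w (b : 'rV[R]_n -> R) y (h : R) :
  (forall x, is_derive x w f (b x)) ->
  exists2 c, `|c| <= `|h| & f (y + h *: w) - f y = h * b (y + c *: w).
Proof.
move=> db.
have dphi (t : R) : is_derive t 1 (fun s : R => f (y + s *: w)) (b (y + t *: w)).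
  exact/is_derive_line.
have cphi := is_derive1_continuous dphi.
have E0 : f y = f (y + 0 *: w) by rewrite scale0r addr0.
have [h0|h0] := leP 0 h.
  have [|c + E] := @MVT_segment _ _ (fun t => b (y + t *: w)) 0 h h0 (fun t _ => dphi t).
    exact: continuous_subspaceT.
  rewrite in_itv/= => /andP[c0 ch]; exists c; first by rewrite !ger0_norm.
  by rewrite E0 E subr0 mulrC.
have [|c + E] := @MVT_segment _ _ (fun t => b (y + t *: w)) h 0 (ltW h0) (fun t _ => dphi t).
  exact: continuous_subspaceT.
rewrite in_itv/= => /andP[hc c0]; exists c.
  by rewrite (ltr0_norm h0) ler0_norm// lerN2.
by rewrite E0 -opprB E sub0r mulrN opprK mulrC.
Qed.

(** The increment along [h *: (v + w)] is the increment along [h *: v] followed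
    by one along [h *: w]; by the mean value theorem the latter is [h] times a
    value of [b] near [x], which tends to [b x] by continuity. *)
Lemma is_derive_dirD f v w (a : R) (b : 'rV[R]_n -> R) x :
  is_derive x v f a -> (forall y, is_derive y w f (b y)) -> continuous b ->
  is_derive x (v + w) f (a + b x).
Proof.
move=> [dv <-] db cb.
suff H : h^-1 *: ((f \o shift x) (h *: (v + w)) - f x) @[h --> (0:R)^'] -->
    'D_v f x + b x.
  by split; [apply/cvg_ex; eexists; exact: H|exact: cvg_lim H].
have E h : h != 0 -> h^-1 *: ((f \o shift x) (h *: (v + w)) - f x) =
   h^-1 *: ((f \o shift x) (h *: v) - f x) +
   h^-1 *: (f (h *: v + x + h *: w) - f (h *: v + x)).
  move=> h0; rewrite -scalerDr; congr (_ *: _) => /=.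
  by rewrite scalerDr addrAC [RHS]addrC addrA subrK.
apply: (@cvg_trans _ ((h^-1 *: ((f \o shift x) (h *: v) - f x) +
   h^-1 *: (f (h *: v + x + h *: w) - f (h *: v + x))) @[h --> (0:R)^'])).
  apply: near_eq_cvg; near=> h; rewrite E//; near: h; exact: nbhs_dnbhs_neq.
apply: cvgD; first exact: dv.
apply/cvgrPdist_lt => e e0.
have /cvgrPdist_lt/(_ _ e0)/nbhs_ballP[d /= d0 Hd] := cb x.
pose K := `|v| + `|w| + 1.
have K0 : 0 < K by rewrite ltr_wpDl// addr_ge0.
near=> h.
have h0 : h != 0 by near: h; exact: nbhs_dnbhs_neq.
have hd : `|h| < d / K.
  near: h; apply: dnbhs0_lt; exact: divr_gt0.
have [c ch ->] := mvt_line (h *: v + x) h db.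
rewrite [_ *: _]mulKf//; apply: Hd; rewrite -ball_normE/=.
rewrite distrC addrAC addrK.
apply: le_lt_trans (ler_normD _ _) _.
rewrite !normrZ; apply: (@le_lt_trans _ _ (`|h| * K)).
  by rewrite /K !mulrDr -addrA lerD2l ler_wpDr ?mulr_ge0// ler_wpM2r.
by rewrite -ltr_pdivlMr.
Unshelve. all: by end_near. Qed.

(** Continuous partial derivatives give all directional derivatives: decompose
    [w] along the canonical basis and add the directions one by one. *)
Lemma is_derive_gradient f w x :
  (forall i y, derivable f y (delta_mx ord0 i)) ->
  (forall i, continuous (partial i f)) ->
  is_derive x w f (\sum_(i < n) w ord0 i * partial i f x).
Proof.
move=> df cf; rewrite {1}[w]row_sum_delta.
elim: (index_enum _) => [|i s ih]; first by rewrite !big_nil; exact: is_derive0.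
rewrite !big_cons (addrC (w ord0 i *: _)) (addrC (w ord0 i * _)).
have dw y : is_derive y (w ord0 i *: delta_mx ord0 i) f (w ord0 i * partial i f y).
  exact: (is_derive_scale (w ord0 i) (DeriveDef (df i y) erefl)).
have cw : continuous (fun y => w ord0 i * partial i f y).
  by move=> y; apply: continuousM; [exact: cst_continuous|exact: cf].
exact: (is_derive_dirD ih dw cw).
Qed.

End directional_derivatives.

(** * Euclidean geometry and Borel functions *)

Section dot_product.
Context {R : realType} {n : nat}.
Implicit Types (x y z : 'rV[R]_n) (k : R).

Definition dotv x y : R := \sum_(i < n) x ord0 i * y ord0 i.

Lemma dotvC x y : dotv x y = dotv y x.
Proof. by apply: eq_bigr => i _; rewrite mulrC. Qed.

Lemma dotvDl x y z : dotv (x + y) z = dotv x z + dotv y z.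
Proof. by rewrite -big_split; apply: eq_bigr => i _; rewrite mxE mulrDl. Qed.

Lemma dotvZl k x y : dotv (k *: x) y = k * dotv x y.
Proof. by rewrite mulr_sumr; apply: eq_bigr => i _; rewrite mxE mulrA. Qed.

Lemma dotvBl x y z : dotv (x - y) z = dotv x z - dotv y z.
Proof. by rewrite dotvDl -scaleN1r dotvZl mulN1r. Qed.

Lemma dotvDr x y z : dotv x (y + z) = dotv x y + dotv x z.
Proof. by rewrite !(dotvC x) dotvDl. Qed.

Lemma dotvZr k x y : dotv x (k *: y) = k * dotv x y.
Proof. by rewrite !(dotvC x) dotvZl. Qed.

Lemma dotvBr x y z : dotv x (y - z) = dotv x y - dotv x z.
Proof. by rewrite !(dotvC x) dotvBl. Qed.

Lemma enorm_ge0 x : 0 <= enorm x.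
Proof. exact: sqrtr_ge0. Qed.

Lemma dotvv x : dotv x x = enorm x ^+ 2.
Proof.
rewrite sqr_sqrtr; last by apply: sumr_ge0 => i _; exact: sqr_ge0.
by apply: eq_bigr => i _; rewrite expr2.
Qed.

Lemma enorm0_eq0 x : enorm x = 0 -> x = 0.
Proof.
move=> x0; have := dotvv x; rewrite x0 expr0n/= /dotv => /eqP.
rewrite psumr_eq0; last by move=> i _; exact: sqr_ge0.
move=> /allP x0i; apply/rowP => i; rewrite mxE; apply/eqP.
by have := x0i i (mem_index_enum _); rewrite /= mulf_eq0 orbb.
Qed.

Lemma enormZ k x : enorm (k *: x) = `|k| * enorm x.
Proof.
apply/eqP; rewrite -(@eqrXn2 _ 2) ?mulr_ge0 ?enorm_ge0//.
by rewrite exprMn real_normK ?num_real// -!dotvv dotvZl dotvZr mulrA expr2.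
Qed.

Lemma enormB x y : enorm (x - y) = enorm (y - x).
Proof. by rewrite -opprB -scaleN1r enormZ normrN1 mul1r. Qed.

(** Expand the square of the norm of [enorm y ^+ 2 *: x - dotv x y *: y]. *)
Lemma cauchy_schwarz x y : `|dotv x y| <= enorm x * enorm y.
Proof.
have [y0|y0] := eqVneq (enorm y) 0.
  rewrite y0 mulr0 (enorm0_eq0 y0) /dotv big1 ?normr0// => i _.
  by rewrite mxE mulr0.
have yp : 0 < enorm y ^+ 2 by rewrite exprn_gt0// lt_neqAle eq_sym y0 enorm_ge0.
rewrite -(@ler_pXn2r _ 2) ?nnegrE ?mulr_ge0 ?enorm_ge0//.
rewrite real_normK ?num_real// exprMn -(ler_pM2r yp).
have := sqr_ge0 (enorm (enorm y ^+ 2 *: x - dotv x y *: y)).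
rewrite -(dotvv (_ - _)) dotvBl !dotvBr !dotvZl !dotvZr (dotvC y x) !dotvv.
rewrite -subr_ge0; congr (0 <= _); ring.
Qed.

Lemma ler_enormB x y : enorm (x - y) <= enorm x + enorm y.
Proof.
rewrite -(@ler_pXn2r _ 2) ?nnegrE ?addr_ge0 ?enorm_ge0//.
have := le_trans (ler_norm _) (cauchy_schwarz (- x) y).
rewrite -scaleN1r enormZ normrN1 mul1r dotvZl mulN1r => xy.
rewrite -dotvv dotvBl !dotvBr (dotvC y x) !dotvv.
by nra.
Qed.

Lemma dotv_continuous y : continuous (dotv^~ y).
Proof.
apply: continuous_big => [|i _ x]; first exact: add_continuous.
by apply: continuousM; [exact: coord_continuous|exact: cst_continuous].
Qed.

End dot_product.

Lemma continuous_measurable_rV (R : realType) n (f : 'rV[R]_n -> R) :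
  continuous f -> measurable_fun setT f.
Proof.
move=> cf; apply: (measurability _ (RGenOpens.measurableE R)).
move=> _ [_ [a [b ->] <-]]; rewrite setTI; apply: open_measurable_rV.
by apply: open_comp; [move=> x _; exact: cf|exact: interval_open].
Qed.

Lemma continuous_enorm_gradient (R : realType) n (f : 'rV[R]_n -> R) :
  (forall i, continuous (partial i f)) ->
  continuous (fun x => enorm (gradient f x)).
Proof.
move=> cf x; rewrite /enorm.
apply: (@continuous_comp _ _ _ (fun x => \sum_(i < n) gradient f x ord0 i ^+ 2)
  Num.sqrt); last exact: sqrt_continuous.
apply: continuous_big => [|i _ {}x]; first exact: add_continuous.
apply: (@continuous_comp _ _ _ (fun x => gradient f x ord0 i) (fun t => t ^+ 2)).
  rewrite (_ : (fun x => _) = partial i f); first exact: cf.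
  by apply/funext => z; rewrite mxE.
exact: exprn_continuous.
Qed.

(** * The Hardy inequality on one side of a hyperplane *)

Section hardy_halfspace.
Context (R : realType) (p : R) (p1 : 1 < p).
Local Notation mu := (@lebesgue_measure R).
Local Notation q := (p / (p - 1)).

Variables (n : nat) (nu : 'rV[R]_n.+1) (c : R) (E : set 'rV[R]_n.+1).
Variable zeta : 'rV[R]_n.+1 -> R.
Hypotheses (nu1 : enorm nu = 1) (nu0 : nu ord0 ord0 != 0).
Hypothesis smooth_zeta : smooth zeta.
Hypothesis supp_zeta : forall x, Defs.support zeta x -> c < dotv x nu.
Hypothesis mE : measurable E.
Hypothesis E_side : forall x, E x -> c < dotv x nu.
Hypothesis E_star : forall x s, 0 < s <= 1 -> E x ->
  E (x - ((1 - s) * (dotv x nu - c)) *: nu).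

Let d x := dotv x nu - c.

Let czeta : continuous zeta. Proof. by have [] := smooth_zeta [::]. Qed.

Let cpartial i : continuous (partial i zeta).
Proof. by have [] := smooth_zeta [:: i]. Qed.

Let w := (nu ord0 ord0)^-1 *: nu.

Let line (y : 'rV[R]_n) (t : R) : 'rV[R]_n.+1 := cons_rV (0, y) + t *: w.

(* On a line of direction nu, the distance to the hyperplane is an affine
   function of the parameter, of slope 1 / k and vanishing at r.  The factor k in
   u makes u t / (t - r) equal to zeta over that distance, while the derivative
   of u is the derivative of zeta along the unit vector nu. *)
Section line.
Variable y : 'rV[R]_n.
Let L := line y.
Let k := nu ord0 ord0.
Let u t := k * zeta (L t).
Let g t := dotv nu (gradient zeta (L t)).
Let r := - d (cons_rV (0, y)) * k.
Let S := L @^-1` E.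

Let cL : continuous L.
Proof. by move=> t; apply: cvgD; [exact: cvg_cst|exact: scalel_continuous]. Qed.

Let mL : measurable_fun setT L.
Proof.
apply/measurable_fun_coordP => i.
rewrite (_ : (fun t => _) = (fun t => cons_rV (0, y) ord0 i + t * w ord0 i)); last first.
  by apply/funext => t; rewrite !mxE.
by apply: measurable_funD => //; exact: measurable_funM.
Qed.

Let mS : measurable S.
Proof. by rewrite -[X in measurable X]setTI; exact: mL. Qed.

Let dL t : t - r = k * d (L t).
Proof.
rewrite /d /L /line dotvDl !dotvZl dotvv nu1 /r /d /k expr1n; field.
exact: nu0.
Qed.

Let du (t : R) : is_derive t 1 u (g t).
Proof.
have dz := is_derive_gradient w (L t) (fun i x => (smooth_zeta [::]).2 i x) cpartial.
have dt := (is_derive_line _ _ _ _ _).1 dz.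
have := is_deriveZ k dt => /is_derive_eq; apply.
rewrite /g /dotv /GRing.scale/= mulr_sumr; apply: eq_bigr => i _.
by rewrite !mxE mulrA mulVKf.
Qed.

Let cg : continuous g.
Proof.
move=> t; apply: (@continuous_comp _ _ _ L (fun x => dotv nu (gradient zeta x))); first exact: cL.
apply: continuous_big => [|i _ x]; first exact: add_continuous.
apply: continuousM; first exact: cst_continuous.
rewrite (_ : (fun x => _) = partial i zeta); first exact: cpartial.
by apply/funext => z; rewrite mxE.
Qed.

Let u0 : exists2 e, 0 < e & forall t, `|t - r| <= e -> u t = 0.
Proof.
have clo : closed (Defs.support zeta) by exact: closed_closure.
have nLr : (~` Defs.support zeta) (L r).
  move=> /supp_zeta; rewrite -subr_gt0 -/(d _).
  have /eqP := dL r; rewrite subrr eq_sym mulf_eq0 (negbTE nu0)/= => /eqP ->.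
  by rewrite ltxx.
have : nbhs r (L @^-1` ~` Defs.support zeta).
  by apply: cL; apply: open_nbhs_nbhs; split => //; exact: closed_openC.
move=> /nbhs_ballP[e /= e0 He]; exists (e / 2); first exact: divr_gt0.
move=> t tr; rewrite /u; have [->|z0] := eqVneq (zeta (L t)) 0; first by rewrite mulr0.
exfalso; apply: (He t); last exact: subset_closure.
rewrite /ball/= distrC (le_lt_trans tr)// ltr_pdivrMr// ltr_pMr// ltrDl//.
Qed.

(* Moving from t towards r on the line is moving towards the hyperplane along
   nu, so that the slice S inherits the star-shapedness of E. *)
Let star s t : r != t -> 0 < (s - r) / (t - r) <= 1 -> S t -> S s.
Proof.
move=> rt st St; have := E_star st St; congr E; rewrite /L /line.
have tr : t - r != 0 by rewrite subr_eq0 eq_sym.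
have -> : (1 - (s - r) / (t - r)) * (dotv (L t) nu - c) = (t - s) / k.
  have -> : dotv (L t) nu - c = (t - r) / k.
    by rewrite dL mulrC mulKf.
  by rewrite /k; field; rewrite tr nu0.
by rewrite /w -/k -scalerA -addrA -scalerBl opprB addrCA subrr addr0.
Qed.

(** The one-dimensional inequality on each line, in the orientation given by the
    sign of [k], combined with the Cauchy-Schwarz inequality for [nu] and the
    gradient. *)
Lemma hardy_line :
  (\int[mu]_(t in S) (`|zeta (L t) / d (L t)| `^ p)%:E <=
  (q `^ p)%:E * \int[mu]_(t in S) (enorm (gradient zeta (L t)) `^ p)%:E)%E.
Proof.
have k0 : k != 0 := nu0.
have -> : (\int[mu]_(t in S) (`|zeta (L t) / d (L t)| `^ p)%:E =
    \int[mu]_(t in S) (`|u t / (t - r)| `^ p)%:E)%E.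
  apply: eq_integral => t _; rewrite dL /u invfM.
  by rewrite mulrACA mulfV// mul1r.
have le_grad : (\int[mu]_(t in S) (`|g t| `^ p)%:E <=
   \int[mu]_(t in S) (enorm (gradient zeta (L t)) `^ p)%:E)%E.
  have mg : measurable_fun setT (fun t => (enorm (gradient zeta (L t)) `^ p)%:E).
    apply/measurable_EFinP; apply: (@measurableT_comp _ _ _ _ _ _ (@powR R ^~ p)) => //.
    apply: continuous_measurable_fun => t.
    apply: (@continuous_comp _ _ _ L (fun x => enorm (gradient zeta x))); first exact: cL.
    exact: (continuous_enorm_gradient cpartial).
  apply: ge0_le_integral => //.
  - apply: measurable_funTS; apply: measurable_normr_powR.
    exact: continuous_measurable_fun.
  - exact: measurable_funTS.
  - move=> t _; rewrite lee_fin; apply: ge0_ler_powR.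
    + by rewrite ltW// (lt_trans ltr01).
    + by rewrite nnegrE.
    + by rewrite nnegrE enorm_ge0.
    + by rewrite (le_trans (cauchy_schwarz _ _))// nu1 mul1r.
apply: le_trans (lee_wpmul2l _ le_grad); last by rewrite lee_fin powR_ge0.
have [e e0 ue] := u0.
have Sside t : S t -> 0 < d (L t) by move=> /E_side; rewrite -subr_gt0.
have [kp|kn] := ltP 0 k.
- have rS t : S t -> r < t by move=> /Sside; rewrite -(pmulr_rgt0 _ kp) -dL subr_gt0.
  apply: (@hardy_right R p p1 u g r (r + e) S) => //.
  + by rewrite ltrDl.
  + by move=> t /andP[rt te]; apply: ue; rewrite ger0_norm ?subr_ge0// lerBlDl.
  + move=> s t /andP[rs st] St; have rt := rS _ St; apply: star St.
      by rewrite lt_eqF.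
    by rewrite divr_gt0 ?subr_gt0//= ler_pdivrMr ?subr_gt0// mul1r lerD2r.
- have {}kn : k < 0 by rewrite lt_neqAle k0.
  have rS t : S t -> t < r.
    by move=> /Sside; rewrite -(nmulr_rlt0 _ kn) -dL subr_lt0.
  apply: (@hardy_left R p p1 u g r (r - e) S) => //.
  + by rewrite ltrBlDr ltrDl.
  + move=> t /andP[te rt]; apply: ue; rewrite ler0_norm ?subr_le0// opprB.
    by rewrite lerBlDl -lerBlDr.
  + move=> s t /andP[ts sr] St; have rt := rS _ St; apply: star St.
      by rewrite gt_eqF.
    rewrite -mulrNN -invrN !opprB divr_gt0 ?subr_gt0//=.
    by rewrite ler_pdivrMr ?subr_gt0// mul1r lerD2l lerN2.
Qed.

End line.

(** Hardy's inequality for the distance to a hyperplane, on any set [E] that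
    contains with each point the segment from it to its projection on the
    hyperplane, projection excluded: integrate [hardy_line] over all lines of
    direction [nu]. *)
Lemma hardy_halfspace :
  (\int[lebesgue_rV n.+1]_(x in E) (`|zeta x / (dotv x nu - c)| `^ p)%:E <=
  (q `^ p)%:E * \int[lebesgue_rV n.+1]_(x in E) (enorm (gradient zeta x) `^ p)%:E)%E.
Proof.
have w1 : w ord0 ord0 = 1 by rewrite mxE mulVf.
have slice (f : 'rV[R]_n.+1 -> \bar R) : measurable_fun setT f ->
    (forall x, 0 <= f x)%E ->
    (\int[lebesgue_rV n.+1]_(x in E) f x = \int[lebesgue_rV n]_y
       \int[mu]_(t in line y @^-1` E)
       f (line y t))%E /\
    measurable_fun setT (fun y => \int[mu]_(t in line y @^-1` E)
       f (line y t))%E.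
  move=> mf f0.
  have mfE : measurable_fun setT (f \_ E).
    by apply/(measurable_restrictT _ mE); exact: measurable_funTS.
  have fE0 x : (0 <= (f \_ E) x)%E by apply: erestrict_ge0.
  have sE y : (\int[mu]_(t in line y @^-1` E)
       f (line y t) =
       \int[mu]_t (f \_ E) (line y t))%E.
    by rewrite integral_mkcond; exact: eq_integral.
  split.
    rewrite integral_mkcond (slanted_tonelli w1 mfE fE0).
    by apply: eq_integral => y _; rewrite -sE.
  rewrite (_ : (fun y => _) = (fun y => \int[mu]_t (f \_ E) (line y t))%E).
    exact: measurable_slanted.
  by apply/funext => y; rewrite sE.
have mz : measurable_fun setT (fun x => (`|zeta x / d x| `^ p)%:E).
  apply: measurable_normr_div_powR; first exact: continuous_measurable_rV.
  apply: measurable_funB => //; apply: continuous_measurable_rV.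
  exact: dotv_continuous.
have mg : measurable_fun setT (fun x => (enorm (gradient zeta x) `^ p)%:E).
  apply/measurable_EFinP; apply: (@measurableT_comp _ _ _ _ _ _ (@powR R ^~ p)) => //.
  by apply: continuous_measurable_rV; exact: (continuous_enorm_gradient cpartial).
have [-> mZ] := slice _ mz (fun x => eqbRL (lee_fin _ _) (powR_ge0 _ _)).
have [-> mG] := slice _ mg (fun x => eqbRL (lee_fin _ _) (powR_ge0 _ _)).
rewrite -ge0_integralZl//; last 2 first.
- by move=> y _; apply: integral_ge0 => t _; rewrite lee_fin powR_ge0.
- by rewrite lee_fin powR_ge0.
apply: ge0_le_integral; [exact: measurableT| |exact: mZ| |].
- by move=> y _; apply: integral_ge0 => t _; rewrite lee_fin powR_ge0.
- exact: measurable_funeM.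
- by move=> y _; exact: hardy_line.
Qed.
End hardy_halfspace.

(** * Supporting hyperplanes of a bounded convex domain *)

Section convex_domain.
Context {R : realType} {n : nat}.
Variable Omega : set 'rV[R]_n.+1.
Hypothesis domOmega : domain Omega.
Hypothesis bndOmega : bounded_set Omega.
Hypothesis cvxOmega : convex_set (Omega : set (convex_lmodType 'rV[R]_n.+1)).
Implicit Types (x y xi nu v : 'rV[R]_n.+1).

Let Omega0 : Omega !=set0. Proof. by case: domOmega. Qed.
Let oOmega : open Omega. Proof. by case: domOmega. Qed.

Lemma boundary_notin xi : boundary Omega xi -> ~ Omega xi.
Proof. by move=> [_]; rewrite ((interior_id _).1 oOmega). Qed.

Lemma dist_boundary_le x xi : boundary Omega xi ->
  dist_boundary Omega x <= enorm (x - xi).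
Proof.
move=> bxi; apply: ge_inf; last by exists xi.
by exists 0 => _ [y _ <-]; exact: enorm_ge0.
Qed.

Lemma dist_boundary_gt0 x : Omega x -> 0 < dist_boundary Omega x.
Proof.
move=> Ox; have [xi bxi [-> _]] := dist_boundary_min x (ltn0Sn n) Omega0 bndOmega.
rewrite lt_neqAle enorm_ge0 andbT eq_sym; apply/eqP => /enorm0_eq0/eqP.
by rewrite subr_eq0 => /eqP xxi; apply: (boundary_notin bxi); rewrite -xxi.
Qed.

(** Otherwise the segment from [x] to [y] would leave [Omega] without meeting its
    boundary, and the trace of [Omega] on it would be open and closed. *)
Lemma in_domain_of_dist x y : Omega x ->
  enorm (y - x) < dist_boundary Omega x -> Omega y.
Proof.
move=> Ox yx; pose f (t : R) := x + t *: (y - x).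
have cf : continuous f.
  by move=> t; apply: cvgD; [exact: cvg_cst|exact: scalel_continuous].
have clos t : 0 <= t <= 1 -> closure Omega (f t) -> Omega (f t).
  move=> /andP[t0 t1] clt; apply: contrapT => nOt.
  have bt : boundary Omega (f t) by split=> // /interior_subset.
  have := dist_boundary_le x bt; apply/negP; rewrite -ltNge.
  apply: le_lt_trans yx; rewrite enormB /f addrAC subrr add0r enormZ.
  by rewrite ger0_norm// ler_piMl// enorm_ge0.
have := @segment_connected _ 0 1 (`[0, 1] `&` f @^-1` Omega).
move=> /(_ _ _ _)/seteqP[|||_ /(_ 1)].
- by exists 0; rewrite /= in_itv/= lexx ler01 /f scale0r addr0.
- by exists (f @^-1` Omega) => //; exact: open_comp.
- exists (f @^-1` closure Omega).
    by apply: preimage_closed => //; exact: closed_closure.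
  apply/seteqP; split=> t [t01]; last by split => //; exact: clos.
  by split => //; exact: subset_closure.
rewrite /= in_itv/= lexx ler01 => /(_ isT)[_].
by rewrite /f scale1r addrC subrK.
Qed.

Lemma enorm_bounded : exists2 M, 0 <= M & forall y, Omega y -> enorm y <= M.
Proof.
have [M0 [_ /(_ (M0 + 1))]] := bndOmega; rewrite ltrDl ltr01 => /(_ isT) OM.
pose K := `|M0 + 1| + 1.
exists (Num.sqrt (\sum_(i < n.+1) K ^+ 2)) => [|y Oy]; first exact: sqrtr_ge0.
rewrite ler_wsqrtr//; apply: ler_sum => i _.
rewrite -[leLHS]real_normK ?num_real//.
rewrite ler_pXn2r ?nnegrE ?addr_ge0//.
have : ball (0 : 'rV[R]_n.+1) K y.
  rewrite -ball_normE/= sub0r normrN (le_lt_trans (OM y Oy))//.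
  by rewrite (le_lt_trans (ler_norm _))// ltrDl.
by move=> [_ /(_ ord0 i)]; rewrite /ball/= mxE sub0r normrN => /ltW.
Qed.

(** The hyperplane [dotv y nu = support_inf nu] is the supporting hyperplane of
    [Omega] with inner normal [nu]. *)
Definition support_inf nu : R := inf [set dotv y nu | y in Omega].

Lemma support_inf_le nu y : Omega y -> support_inf nu <= dotv y nu.
Proof.
move=> Oy; apply: ge_inf; last by exists y.
have [M M0 OM] := enorm_bounded.
exists (- (M * enorm nu)) => _ [z Oz <-].
rewrite lerNl (le_trans (ler_norm _))// normrN (le_trans (cauchy_schwarz _ _))//.
by rewrite ler_wpM2r ?enorm_ge0// OM.
Qed.

Lemma support_inf_ge nu a : (forall y, Omega y -> a <= dotv y nu) ->
  a <= support_inf nu.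
Proof.
move=> H; apply: lb_le_inf; last by move=> _ [y Oy <-]; exact: H.
by have [x Ox] := Omega0; exists (dotv x nu), x.
Qed.

(** A point of [Omega] is at least as far from a supporting hyperplane as from
    the boundary: going from [x] by less than the distance to the boundary in the
    direction [- nu] stays in [Omega]. *)
Lemma dist_boundary_le_slab x nu : Omega x -> enorm nu = 1 ->
  dist_boundary Omega x <= dotv x nu - support_inf nu.
Proof.
move=> Ox nu1.
have ball_le s : 0 <= s -> s < dist_boundary Omega x ->
    s <= dotv x nu - support_inf nu.
  move=> s0 sd; have Oy : Omega (x - s *: nu).
    apply: (in_domain_of_dist Ox); rewrite addrAC subrr add0r -scaleNr enormZ.
    by rewrite nu1 mulr1 normrN ger0_norm.
  have := support_inf_le nu Oy; rewrite dotvBl dotvZl dotvv nu1 expr1n mulr1.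
  by rewrite lerBrDr addrC -lerBrDr.
rewrite leNgt; apply/negP => dlt.
have d0 := ball_le 0 (lexx _) (dist_boundary_gt0 Ox).
set d := dotv x nu - _ in ball_le dlt d0 *.
have [m1 m2] := midf_lt dlt.
have := ball_le _ (ltW (le_lt_trans d0 m1)) m2.
by rewrite leNgt m1.
Qed.

Lemma convex_comb x y t : 0 <= t <= 1 -> Omega x -> Omega y ->
  Omega (t *: x + (1 - t) *: y).
Proof.
move=> /andP[t0 t1] Ox Oy.
have := cvxOmega (Itv01 t0 t1) (mem_set Ox) (mem_set Oy).
by rewrite inE.
Qed.

(** The hyperplane through a nearest boundary point [xi], orthogonal to
    [x - xi], supports [Omega].  If some [y] in [Omega] were on its wrong side, a
    point [z] slightly beyond [xi] on the half-line from [y] would be closer to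
    [x] than [xi], hence in [Omega], and [xi] would be in [Omega] by convexity. *)
Lemma supporting_hyperplane x : Omega x -> exists xi nu,
  [/\ enorm nu = 1, dotv (x - xi) nu = dist_boundary Omega x
    & forall y, Omega y -> dotv xi nu <= dotv y nu].
Proof.
move=> Ox; have d0 := dist_boundary_gt0 Ox.
have [xi bxi [dE _]] := dist_boundary_min x (ltn0Sn n) Omega0 bndOmega.
set d := dist_boundary Omega x in d0 dE.
exists xi, (d^-1 *: (x - xi)).
have xixi : dotv (x - xi) (x - xi) = d ^+ 2 by rewrite dotvv -dE.
split.
- by rewrite enormZ -dE ger0_norm ?mulVf ?gt_eqF// invr_ge0 ltW.
- by rewrite dotvZr xixi expr2 mulKf// gt_eqF.
move=> y Oy; rewrite !dotvZr ler_pM2l ?invr_gt0// leNgt; apply/negP => yxi.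
apply: (boundary_notin bxi).
pose c := dotv (xi - y) (x - xi).
have c0 : 0 < c by rewrite /c dotvBl subr_gt0.
pose e := enorm (xi - y) ^+ 2.
have e0 : 0 <= e by exact: sqr_ge0.
(* small enough for tau ^ 2 * e < 2 * tau * c *)
pose tau := c / (e + 1).
have e1 : 0 < e + 1 by rewrite ltr_wpDl.
have tau0 : 0 < tau by rewrite divr_gt0.
pose z := xi + tau *: (xi - y).
have Oz : Omega z.
  apply: (in_domain_of_dist Ox); rewrite -/d.
  rewrite -(@ltr_pXn2r _ 2) ?nnegrE ?enorm_ge0 ?(ltW d0)// -dotvv.
  have -> : z - x = tau *: (xi - y) - (x - xi).
    by rewrite /z opprB addrAC addrC.
  have expand a b : dotv (tau *: a - b) (tau *: a - b) =
      tau * (tau * dotv a a) - tau * dotv a b - (tau * dotv a b - dotv b b).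
    by rewrite dotvBl !dotvBr !dotvZl !dotvZr (dotvC b a).
  rewrite expand xixi -/c dotvv -/e.
  have te : tau * (e + 1) = c by rewrite divfK// gt_eqF.
  nra.
have T1 : 0 < 1 + tau by rewrite ltr_pwDl// ltW.
have := @convex_comb z y (1 + tau)^-1; rewrite invr_ge0 (ltW T1)/=.
rewrite invf_le1// lerDl (ltW tau0) => /(_ isT Oz Oy).
congr Omega; apply: (scalerI (lt0r_neq0 T1)).
rewrite scalerDr !scalerA mulfV ?gt_eqF// scale1r mulrBr mulr1 mulfV ?gt_eqF//.
rewrite (addrAC 1 tau) subrr add0r /z scalerBr -addrA subrK.
by rewrite scalerDl scale1r.
Qed.

End convex_domain.

(** * Countably many half-spaces *)

Section rational_directions.
Context {R : realType} {n : nat}.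
Implicit Types (x xi nu v : 'rV[R]_n.+1).

(** Rational vectors, normalized.  The fallback to the first basis vector keeps
    the first coordinate nonzero, as required for slicing by [slanted_tonelli]. *)
Definition unit_direction (q : 'rV[rat]_n.+1) : 'rV[R]_n.+1 :=
  let v := map_mx (ratr : rat -> R) q in
  if v ord0 ord0 == 0 then delta_mx ord0 ord0 else (enorm v)^-1 *: v.

Definition direction (j : nat) : 'rV[R]_n.+1 :=
  unit_direction (odflt 0 (unpickle j)).

Lemma enorm_gt0 v : v != 0 -> 0 < enorm v.
Proof.
move=> v0; rewrite lt_neqAle enorm_ge0 andbT eq_sym.
by apply: contra_neq v0; exact: enorm0_eq0.
Qed.

Lemma coord0_neq0 v : v ord0 ord0 != 0 -> v != 0.
Proof. by apply: contra_neq => ->; rewrite mxE. Qed.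

Lemma enorm_direction j : enorm (direction j) = 1.
Proof.
rewrite /direction /unit_direction; case: ifPn => [_|/coord0_neq0 v0].
  rewrite /enorm big_ord_recl big1 ?addr0 => [|i _]; rewrite mxE ?eqxx.
    by rewrite expr1n sqrtr1.
  by rewrite eq_sym (negbTE (neq_lift _ _)) expr0n.
by rewrite enormZ ger0_norm ?invr_ge0 ?enorm_ge0// mulVf// gt_eqF// enorm_gt0.
Qed.

Lemma direction_coord0_neq0 j : direction j ord0 ord0 != 0.
Proof.
rewrite /direction /unit_direction; case: ifPn => [_|v0].
  by rewrite mxE !eqxx oner_eq0.
by rewrite mxE mulf_neq0// invr_neq0// gt_eqF// enorm_gt0// coord0_neq0.
Qed.

(** All coordinates of the approximating rational vector are taken nonzero, so
    that the fallback of [unit_direction] does not interfere. *)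
Lemma direction_dense (U : set 'rV[R]_n.+1) nu : nbhs nu U ->
  exists j, exists2 v, U v & v != 0 /\ direction j = (enorm v)^-1 *: v.
Proof.
move=> /nbhs_ballP[e /= e0 eU].
have /choice[f fP] i : exists q : rat,
    ratr q != 0 :> R /\ ball (nu ord0 i) e (ratr q).
  have [nu0|nu0] := leP 0 (nu ord0 i).
    have [|q] := @rat_in_itvoo R (nu ord0 i) (nu ord0 i + e); first by rewrite ltrDl.
    rewrite in_itv/= => /andP[q1 q2]; exists q.
    rewrite gt_eqF ?(le_lt_trans nu0)//; split => //.
    by rewrite /ball/= ltr_norml; apply/andP; split; lra.
  have [|q] := @rat_in_itvoo R (nu ord0 i - e) (nu ord0 i); first by rewrite gtrBl.
  rewrite in_itv/= => /andP[q1 q2]; exists q.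
  rewrite lt_eqF ?(lt_trans q2)//; split => //.
  by rewrite /ball/= ltr_norml; apply/andP; split; lra.
pose q : 'rV[rat]_n.+1 := \row_i f i.
pose v := map_mx (ratr : rat -> R) q.
have v0 : v ord0 ord0 != 0 by rewrite !mxE; case: (fP ord0).
exists (pickle q), v.
  apply: eU; split=> // i j; rewrite ord1 !mxE; by case: (fP j).
by rewrite coord0_neq0// /direction pickleK /= /unit_direction -/v (negbTE v0).
Qed.

End rational_directions.

Section slabs.
Context {R : realType} {n : nat}.
Variable Omega : set 'rV[R]_n.+1.
Hypothesis domOmega : domain Omega.
Hypothesis bndOmega : bounded_set Omega.
Hypothesis cvxOmega : convex_set (Omega : set (convex_lmodType 'rV[R]_n.+1)).

Definition slab_dist (j : nat) (x : 'rV[R]_n.+1) : R :=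
  dotv x (direction j) - support_inf Omega (direction j).

(** For the inner normal [nu] at a nearest boundary point the distance to the
    supporting hyperplane is the distance to the boundary; for [v] close to [nu],
    the function [G] bounds the distance to the supporting hyperplane with normal
    [v / enorm v], and [G] is continuous at [nu]. *)
Lemma slab_dist_dense x (e : R) : Omega x -> 0 < e ->
  exists j, slab_dist j x < dist_boundary Omega x + e.
Proof.
move=> Ox e0; have [xi [nu [nu1 xnu nule]]] := supporting_hyperplane domOmega bndOmega cvxOmega Ox.
set d := dist_boundary Omega x in xnu *.
have [M M0 OM] := enorm_bounded bndOmega.
pose K := enorm xi + M.
pose G (v : 'rV[R]_n.+1) := (dotv v (x - xi) + K * enorm (v - nu)) / enorm v.
have Gnu : G nu = d.
  rewrite /G subrr nu1 divr1 dotvC xnu -(scale0r nu) enormZ normr0 mul0r mulr0.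
  by rewrite addr0.
have cG : {for nu, continuous G}.
  have cB : {for nu, continuous (fun v : 'rV[R]_n.+1 => enorm (v - nu))}.
    apply: (@continuous_comp _ _ _ (fun v : 'rV[R]_n.+1 => v - nu) enorm); last exact: enorm_continuous.
    by apply: continuousB; [exact: cvg_id|exact: cst_continuous].
  have cV : {for nu, continuous (fun v : 'rV[R]_n.+1 => (enorm v)^-1)}.
    by apply: continuousV; [rewrite nu1 oner_neq0|exact: enorm_continuous].
  have cN : {for nu, continuous (fun v : 'rV[R]_n.+1 => dotv v (x - xi) + K * enorm (v - nu))}.
    apply: continuousD; first exact: dotv_continuous.
    by apply: continuousM => //; exact: cst_continuous.
  exact: continuousM.
have : nbhs nu [set v | G v < d + e].
  have /cvgr_lt := cG; rewrite Gnu; apply; by rewrite ltrDl.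
move=> /direction_dense[j [v Gv [v0 jv]]]; exists j.
have ev := enorm_gt0 v0.
apply: le_lt_trans Gv; rewrite /slab_dist jv.
rewrite /G mulrC lerBlDl -lerBlDr.
apply: support_inf_ge => // y Oy.
rewrite !dotvZr -mulrBr ler_pM2l ?invr_gt0//.
rewrite lerBlDr -lerBlDl -dotvBl.
have -> : x - y = (x - xi) + (xi - y) by rewrite addrA subrK.
rewrite dotvDl dotvC lerD2l.
have -> : dotv (xi - y) v = dotv (xi - y) nu + dotv (xi - y) (v - nu).
  by rewrite -dotvDr [nu + _]addrC subrK.
apply: (@le_trans _ _ (0 + K * enorm (v - nu))); last by rewrite add0r.
apply: lerD; first by rewrite dotvBl subr_le0 nule.
apply: le_trans (ler_norm _) (le_trans (cauchy_schwarz _ _) _).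
rewrite ler_wpM2r ?enorm_ge0//.
by rewrite (le_trans (ler_enormB _ _))// lerD2l OM.
Qed.

(** Inside the circumscribed polyhedron cut out by the first [N.+1] half-spaces,
    the distance to its boundary. *)
Fixpoint slab_min (N : nat) (x : 'rV[R]_n.+1) : R :=
  if N is N'.+1 then Num.min (slab_min N' x) (slab_dist N x) else slab_dist 0 x.

Lemma slab_min_le N k x : (k <= N)%N -> slab_min N x <= slab_dist k x.
Proof.
elim: N => [|N ih] /=; first by rewrite leqn0 => /eqP ->.
rewrite leq_eqVlt => /predU1P[->|kN]; first by rewrite ge_min lexx orbT.
by rewrite ge_min ih.
Qed.

Lemma slab_min_ge N x a : (forall k, (k <= N)%N -> a <= slab_dist k x) ->
  a <= slab_min N x.
Proof.
elim: N => [|N ih] /= H; first exact: H.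
by rewrite le_min H// andbT ih// => k kN; apply: H; exact: leqW.
Qed.

Lemma slab_min_attained N x :
  exists2 j, (j <= N)%N & slab_dist j x = slab_min N x.
Proof.
elim: N => [|N [j jN jE]] /=; first by exists 0%N.
by rewrite minEle; case: ifPn => _; [exists j => //; exact: leqW|exists N.+1].
Qed.

Lemma slab_min_nincr x : {homo slab_min ^~ x : N M / (N <= M)%N >-> M <= N}.
Proof.
by move=> N M NM; apply: slab_min_ge => k kN; apply: slab_min_le; exact: leq_trans NM.
Qed.

Lemma slab_dist_continuous j : continuous (slab_dist j).
Proof.
move=> x; apply: (@continuousB _ _ _ (dotv^~ (direction j))
  (cst (support_inf Omega (direction j)))).
  exact: dotv_continuous.
exact: cst_continuous.
Qed.

Lemma slab_min_measurable N : measurable_fun setT (slab_min N).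
Proof.
elim: N => [|N ih] /=.
  by apply: continuous_measurable_rV; exact: slab_dist_continuous.
apply: measurable_minr => //.
by apply: continuous_measurable_rV; exact: slab_dist_continuous.
Qed.

Lemma dist_boundary_le_slab_min N x : Omega x ->
  dist_boundary Omega x <= slab_min N x.
Proof.
move=> Ox; apply: slab_min_ge => k _; apply: dist_boundary_le_slab => //.
exact: enorm_direction.
Qed.

Lemma slab_min_cvg x : Omega x ->
  slab_min N x @[N --> \oo] --> dist_boundary Omega x.
Proof.
move=> Ox; apply/cvgrPdist_lt => e e0.
have [j jlt] := slab_dist_dense Ox e0.
exists j => // N /= jN; rewrite distrC ger0_norm ?subr_ge0 ?dist_boundary_le_slab_min//.
by rewrite ltrBlDl (le_lt_trans _ jlt)// slab_min_le.
Qed.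

End slabs.

(** * The Hardy inequality in a convex domain *)

Section hardy_convex.
Context {R : realType} {n : nat}.
Variables (p : R) (Omega : set 'rV[R]_n.+1) (zeta : 'rV[R]_n.+1 -> R).
Hypothesis p1 : 1 < p.
Hypothesis domOmega : domain Omega.
Hypothesis bndOmega : bounded_set Omega.
Hypothesis cvxOmega : convex_set (Omega : set (convex_lmodType 'rV[R]_n.+1)).
Hypothesis csupp_zeta : smooth_compact_support Omega zeta.
Local Notation q := (p / (p - 1)).
Local Notation lam := (lebesgue_rV n.+1).
Local Notation slab_dist := (slab_dist Omega).
Local Notation slab_min := (slab_min Omega).

Let p0 : 0 < p. Proof. by rewrite (lt_trans ltr01). Qed.

Let czeta : continuous zeta.
Proof. by have [/(_ [::])[]] := csupp_zeta. Qed.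

Let cpartial i : continuous (partial i zeta).
Proof. by have [/(_ [:: i])[]] := csupp_zeta. Qed.

Let oOmega : open Omega. Proof. by case: domOmega. Qed.

Let mOmega : measurable Omega. Proof. exact: open_measurable_rV. Qed.

Let G x : \bar R := (enorm (gradient zeta x) `^ p)%:E.

Let G0 x : (0 <= G x)%E. Proof. by rewrite lee_fin powR_ge0. Qed.

Let mG : measurable_fun setT G.
Proof.
apply/measurable_EFinP; apply: (@measurableT_comp _ _ _ _ _ _ (@powR R ^~ p)) => //.
by apply: continuous_measurable_rV; exact: (continuous_enorm_gradient cpartial).
Qed.

Let gradient_out x : ~ Omega x -> G x = 0%E.
Proof.
move=> nOx; have [_ _ sO] := csupp_zeta.
have nz : \forall y \near x, zeta y = 0.
  have : nbhs x (~` Defs.support zeta).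
    apply: open_nbhs_nbhs; split; last by move=> /sO.
    by apply: closed_openC; exact: closed_closure.
  apply: filterS => y ny; apply: contrapT => /eqP zy; apply: ny.
  exact: subset_closure.
have grad0 : gradient zeta x = 0.
  apply/rowP => i; rewrite !mxE /partial.
  rewrite (@near_eq_derive _ _ _ _ (cst 0))//.
  exact: derive_cst.
rewrite /G grad0 -(scale0r (0 : 'rV[R]_n.+1)) enormZ normr0 mul0r powR0//.
by rewrite gt_eqF.
Qed.

Let integral_gradient :
  (\int[lam]_x G x = \int[lam]_(x in Omega) G x)%E.
Proof.
rewrite [RHS]integral_mkcond; apply: eq_integral => x _; rewrite patchE.
by case: ifPn => //; rewrite notin_setE => /gradient_out.
Qed.

Section approximation.
Variable N : nat.

(** The part of the polyhedron whose nearest face is the [j]-th one, ties being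
    broken in favour of the smallest index so that the pieces are disjoint. *)
Definition slab_piece (j : nat) : set 'rV[R]_n.+1 :=
  [set x | 0 < slab_min N x] `&` [set x | slab_dist j x = slab_min N x] `&`
  [set x | forall k, (k < j)%N -> slab_min N x < slab_dist k x].

Lemma slab_piece_measurable j : measurable (slab_piece j).
Proof.
have mlt (f g : 'rV[R]_n.+1 -> R) : measurable_fun setT f ->
    measurable_fun setT g -> measurable [set x | f x < g x].
  move=> mf mg; rewrite (_ : mkset _ = setT `&` (g \- f) @^-1` `]0, +oo[%classic).
    by apply: measurable_funB.
  by apply/seteqP; split=> x /=; rewrite in_itv/= andbT subr_gt0// => -[].
have md k : measurable_fun setT (slab_dist k).
  by apply: continuous_measurable_rV; exact: slab_dist_continuous.
have mm := slab_min_measurable Omega N.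
apply: measurableI; first apply: measurableI.
- exact: mlt.
- rewrite (_ : mkset _ = setT `&` (slab_dist j \- slab_min N) @^-1` [set 0]).
    by apply: measurable_funB.
  apply/seteqP; split=> x /=; first by move=> ->; rewrite subrr.
  by move=> [_ /eqP]; rewrite subr_eq0 => /eqP.
- rewrite (_ : mkset _ = \bigcap_k [set x | (k < j)%N -> slab_min N x < slab_dist k x]).
    apply: bigcapT_measurable => k; have [kj|jk] := ltnP k j.
      rewrite (_ : mkset _ = [set x | slab_min N x < slab_dist k x]); first exact: mlt.
      by apply/seteqP; split=> x /=; [exact|].
    rewrite (_ : mkset _ = setT); first exact: measurableT.
    by apply/seteqP; split.
  by apply/seteqP; split=> x /= H k; [move=> _|]; exact: H.
Qed.

(** Moving towards the nearest face by some length decreases the distance to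
    that face by this length, and the distance to the other faces by at most as
    much, by the Cauchy-Schwarz inequality between unit normals.  Hence the
    nearest face does not change. *)
Lemma slab_piece_star j x s : (j <= N)%N -> 0 < s <= 1 -> slab_piece j x ->
  slab_piece j (x - ((1 - s) * slab_dist j x) *: direction j).
Proof.
move=> jN /andP[s0 s1] [[/= m0 dj] jfirst].
set m := slab_min N x in m0 dj jfirst.
set x' := x - _.
have dotle k : dotv (direction j : 'rV[R]_n.+1) (direction k) <= 1.
  have := le_trans (ler_norm _) (cauchy_schwarz (direction j : 'rV[R]_n.+1) (direction k)).
  by rewrite !enorm_direction mulr1.
have dE k : slab_dist k x' =
    slab_dist k x - (1 - s) * m * dotv (direction j : 'rV[R]_n.+1) (direction k).
  by rewrite /slab_dist /x' dj dotvBl dotvZl addrAC.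
have dge k : slab_dist k x - (1 - s) * m <= slab_dist k x'.
  rewrite dE lerD2l lerN2 ler_piMr//.
  by rewrite mulr_ge0 ?subr_ge0// ltW.
have djx' : slab_dist j x' = s * m.
  by rewrite dE dotvv enorm_direction expr1n mulr1 dj; ring.
have mx' : slab_min N x' = s * m.
  apply/eqP; rewrite eq_le; apply/andP; split.
    by rewrite -djx' slab_min_le.
  apply: slab_min_ge => k kN; apply: le_trans (dge k).
  have := slab_min_le Omega x kN; rewrite -/m => mk.
  by rewrite lerBrDr (le_trans _ mk)// -mulrDl addrC subrK mul1r.
split; first split => /=.
- by rewrite mx' mulr_gt0.
- by rewrite djx' mx'.
- move=> k kj; rewrite mx'; apply: lt_le_trans (dge k).
  by rewrite ltrBrDr (le_lt_trans _ (jfirst _ kj))// -mulrDl addrC subrK mul1r.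
Qed.

Lemma slab_piece_trivIset : trivIset setT slab_piece.
Proof.
apply/trivIsetP => i j _ _; wlog : i j / (i < j)%N => [hw ij|ij _].
  have [lt_ij|lt_ji] := ltnP i j; first exact: hw.
  by rewrite setIC hw ?(eq_sym j)// ltn_neqAle eq_sym ij.
apply/seteqP; split=> // x [[[_ /= di] _] [_ /= /(_ i ij)]].
by rewrite di ltxx.
Qed.

Lemma slab_piece_cover :
  Omega `<=` \big[setU/set0]_(j <- iota 0 N.+1) slab_piece j.
Proof.
move=> x Ox.
have exj : exists j, (j <= N)%N && (slab_dist j x == slab_min N x).
  by have [j jN jE] := slab_min_attained Omega N x; exists j; rewrite jN jE eqxx.
case: (ex_minnP exj) => j /andP[jN /eqP jE] jmin.
rewrite -bigcup_seq; exists j; first by rewrite /mkset mem_iota add0n ltnS.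
split; first split => //=.
  apply: lt_le_trans (dist_boundary_le_slab_min _ _ N Ox) => //.
  exact: dist_boundary_gt0.
move=> k kj; rewrite lt_neqAle slab_min_le ?andbT; last first.
  exact: leq_trans (ltnW kj) jN.
apply/eqP => kE; have := jmin k; rewrite -kE eqxx (leq_trans (ltnW kj) jN).
by rewrite leqNgt kj => /(_ isT).
Qed.

(** Hardy's inequality for the distance to the boundary of the polyhedron:
    sum [hardy_halfspace] over the pieces. *)
Lemma hardy_slab_min :
  (\int[lam]_(x in Omega) (`|zeta x / slab_min N x| `^ p)%:E <=
   (q `^ p)%:E * \int[lam]_(x in Omega) G x)%E.
Proof.
have mz : measurable_fun setT (fun x => (`|zeta x / slab_min N x| `^ p)%:E).
  apply: measurable_normr_div_powR; first exact: continuous_measurable_rV.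
  exact: slab_min_measurable.
have mD : measurable (\big[setU/set0]_(j <- iota 0 N.+1) slab_piece j).
  by apply: bigsetU_measurable => j _; exact: slab_piece_measurable.
have tp : trivIset [set` iota 0 N.+1] slab_piece.
  exact: sub_trivIset slab_piece_trivIset.
apply: (@le_trans _ _ (\int[lam]_(x in \big[setU/set0]_(j <- iota 0 N.+1) slab_piece j)
    (`|zeta x / slab_min N x| `^ p)%:E)%E).
  apply: ge0_subset_integral => //.
  - exact: measurable_funTS.
  - exact: slab_piece_cover.
rewrite ge0_integral_bigsetU//; last 3 first.
- exact: slab_piece_measurable.
- exact: iota_uniq.
- exact: measurable_funTS.
apply: (@le_trans _ _ (\sum_(j <- iota 0 N.+1) (q `^ p)%:E * \int[lam]_(x in slab_piece j) G x)%E).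
  rewrite big_seq [leRHS]big_seq; apply: lee_sum => j; rewrite mem_iota add0n ltnS => /= jN.
  have [_ _ sO] := csupp_zeta.
  rewrite (_ : (\int[lam]_(x in slab_piece j) _ = \int[lam]_(x in slab_piece j)
      (`|zeta x / slab_dist j x| `^ p)%:E)%E); last first.
    by apply: eq_integral => x; rewrite inE => -[[_ /= ->]].
  apply: (@hardy_halfspace R p p1 n (direction j)) => //.
  - exact: enorm_direction.
  - exact: direction_coord0_neq0.
  - by have [] := csupp_zeta.
  - move=> x /sO Ox; rewrite -subr_gt0.
    apply: lt_le_trans (dist_boundary_le_slab domOmega bndOmega Ox (enorm_direction j)).
    exact: dist_boundary_gt0.
  - exact: slab_piece_measurable.
  - by move=> x [[/= m0 dj] _]; rewrite -subr_gt0 -[X in 0 < X]/(slab_dist j x) dj.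
  - by move=> x s s01; exact: slab_piece_star.
rewrite -ge0_sume_distrr; last by move=> j _; apply: integral_ge0.
rewrite -ge0_integral_bigsetU//; last 3 first.
- exact: slab_piece_measurable.
- exact: iota_uniq.
- exact: measurable_funTS.
rewrite -integral_gradient lee_wpmul2l ?lee_fin ?powR_ge0//.
by apply: ge0_subset_integral.
Qed.

End approximation.

(** Let the circumscribed polyhedra shrink to [Omega], by monotone convergence. *)
Lemma hardy_convex :
  (\int[lam]_(x in Omega) (`|zeta x / dist_boundary Omega x| `^ p)%:E <=
   (q `^ p)%:E * \int[lam]_(x in Omega) G x)%E.
Proof.
pose f N x : \bar R := (`|zeta x / slab_min N x| `^ p)%:E.
have fcvg x : Omega x ->
    f N x @[N --> \oo] --> (`|zeta x / dist_boundary Omega x| `^ p)%:E.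
  move=> Ox; apply: cvg_EFin; first by near=> N.
  have d0 := dist_boundary_gt0 domOmega bndOmega Ox.
  have cd := slab_min_cvg domOmega bndOmega cvxOmega Ox.
  apply: (@continuous_cvg _ _ _ _ _ _ (fun t => `|t| `^ p)).
    exact: powR_norm_continuous.
  apply: cvgM; first exact: cvg_cst.
  by apply: cvgV; rewrite ?gt_eqF.
have -> : (\int[lam]_(x in Omega) (`|zeta x / dist_boundary Omega x| `^ p)%:E =
    \int[lam]_(x in Omega) limn (f ^~ x))%E.
  by apply: eq_integral => x; rewrite inE => /fcvg/cvg_lim ->.
have mf N : measurable_fun Omega (f N).
  apply: measurable_funTS; apply: measurable_normr_div_powR.
    exact: continuous_measurable_rV.
  exact: slab_min_measurable.
have f0 N x : Omega x -> (0 <= f N x)%E by rewrite lee_fin powR_ge0.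
have fnd x : Omega x -> nondecreasing_seq (f ^~ x).
  move=> Ox N M NM; rewrite lee_fin.
  have mpos K : 0 < slab_min K x.
    apply: lt_le_trans (dist_boundary_le_slab_min _ _ K Ox) => //.
    exact: dist_boundary_gt0.
  apply: ge0_ler_powR; rewrite ?nnegrE//; first exact: ltW.
  have mV K : `|(slab_min K x)^-1| = (slab_min K x)^-1.
    by rewrite ger0_norm// invr_ge0 ltW.
  rewrite !normrM !mV ler_wpM2l//.
  by rewrite lef_pV2 ?posrE// slab_min_nincr.
rewrite monotone_convergence//; apply: lime_le.
  apply/cvg_ex; eexists.
  exact: (@cvg_monotone_convergence _ _ _ lam Omega mOmega f mf f0 fnd).
by apply: nearW => N; exact: hardy_slab_min.
Unshelve. all: by end_near. Qed.

End hardy_convex.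

Unset Implicit Arguments.

Theorem mainTheorem1 (R : realType) (n : nat) (p : R) (Omega : set 'rV[R]_n)
    (n_gt0 : (0 < n)%N) (p_gt1 : 1 < p)
    (domOmega : domain Omega) (bndOmega : bounded_set Omega)
    (cvxOmega : convex_set (Omega : set (convex_lmodType 'rV[R]_n))) :
  forall zeta : 'rV[R]_n -> R, smooth_compact_support Omega zeta ->
  (\int[lebesgue_rV n]_(x in Omega)
      (`|zeta x / dist_boundary Omega x| `^ p)%:E <=
   ((p / (p - 1)) `^ p)%:E *
     \int[lebesgue_rV n]_(x in Omega) (enorm (gradient zeta x) `^ p)%:E)%E.
Proof.
case: n n_gt0 Omega domOmega bndOmega cvxOmega => // n _ Omega dO bO cO zeta sz.
exact: hardy_convex.
Qed.
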